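(* Let $1<\alpha<2$, let $a=x_0<x_1<\dots<x_N=b$ be a partition with $h_i=x_i-x_{i-1}$, let $\lambda>0$ and $R\in\mathbb{N}$. Let $\vartheta_1,\vartheta_2$ be index subsets such that $\vartheta_1\times\vartheta_2$ is admissible with parameter $\lambda$ with respect to the basis function groups relevant to the entry considered (see context), and suppose that the corresponding support unions are intervals $\tau_{\vartheta_1}=[a',b']$ and $\tau_{\vartheta_2}=[c',d']$ with $d'<a'$. Put $s_0=(c'+d')/2$, $$\delta_\lambda=\frac{\lambda}{2+\lambda},\qquad c_0=\frac{1}{(|a'-d'|+|d'-s_0|)^{\alpha}}\Big(1+\frac{\lambda}{2}\Big)\Big(R+1+\frac{\lambda}{2}\Big).$$ Then for all $(i,j)\in\vartheta_1\times\vartheta_2$ and all $1\le p\le P_i-1$, $1\le q\le P_j-1$, the matrix entries $B_{ij}^{pq},C_{ij},E_{ij}^q,F_{ij}^p$ and their rank-$R$ approximations $\tilde B_{ij}^{pq},\tilde C_{ij},\tilde E_{ij}^q,\tilde F_{ij}^p$ (defined in the context) satisfy $$|B_{ij}^{pq}-\tilde B_{ij}^{pq}|\le\frac{8h_ic_0}{\Gamma(2-\alpha)}\,\delta_\lambda^{R},\qquad |C_{ij}-\tilde C_{ij}|\le\frac{(h_i+h_{i+1})c_0}{\Gamma(2-\alpha)}\,\delta_\lambda^{R},$$ $$|E_{ij}^{q}-\tilde E_{ij}^{q}|\le\frac{2(h_i+h_{i+1})c_0}{\Gamma(2-\alpha)}\,\delta_\lambda^{R},\qquad |F_{ij}^{p}-\tilde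 F_{ij}^{p}|\le\frac{4h_ic_0}{\Gamma(2-\alpha)}\,\delta_\lambda^{R}.$$
   Context: Basis functions. Let $a=x_0<\dots<x_N=b$ and let $P_1,\dots,P_N$ be positive integers (polynomial degrees). Nodal basis: for $1\le j\le N-1$, $\varphi_j$ is the continuous function on $[a,b]$, linear on each $[x_{k-1},x_k]$, with $\varphi_j(x_k)=\delta_{jk}$; its support is $[x_{j-1},x_{j+1}]$. Modal basis: let $L_p$ be the Legendre polynomial of degree $p$ on $[-1,1]$ (normalized by $L_p(1)=1$) and $\psi_p=L_{p-1}-L_{p+1}$ for $p\ge1$. For $1\le i\le N$ and $1\le p\le P_i-1$, $\phi_i^p(x)=\psi_p\big(\tfrac{2x-(x_{i-1}+x_i)}{x_i-x_{i-1}}\big)$ for $x\in[x_{i-1},x_i]$ and $\phi_i^p=0$ elsewhere. Derivatives of basis functions are taken piecewise. Exact entries (for pairs of basis functions with the support of the $j$-function to the left of the support of the $i$-function). For such functions $v$ (index $i$) and $u$ (index $j$) set $$\mathcal{S}(v,u)=\frac{1}{\Gamma(2-\alpha)}\int_{\mathrm{supp}\,v} v'(t)\int_{\mathrm{supp}\,u}(t-s)^{1-\alpha}u'(s)\,ds\,dt .$$ Then $B_{ij}^{pq}=\mathcal S(\phi_i^p,\phi_j^q)$, $C_{ij}=\mathcal S(\varphi_i,\varphi_j)$, $E_{ij}^q=\mathcal S(\varphi_i,\phi_j^q)$, $F_{ij}^p=\mathcal S(\phi_i^p,\varphi_j)$. These are entries of the stiffness matrix of the left-sided fractional derivative of order $\alpha$.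 Admissibility. Two bounded intervals $\tau,\sigma$ are admissible with parameter $\lambda>0$ if $\max\{\mathrm{diam}(\sigma),\mathrm{diam}(\tau)\}\le\lambda\,\mathrm{dist}(\tau,\sigma)$. For index subsets $\vartheta_1,\vartheta_2\subset\{1,\dots,N\}$ (subsets of $\{1,\dots,N-1\}$ when the associated basis functions are nodal), $\tau_{\vartheta_1}$ is the union over $i\in\vartheta_1$ of the supports of the basis functions with index $i$ used for the row index, and $\tau_{\vartheta_2}$ is the union over $j\in\vartheta_2$ of the supports of the basis functions with index $j$ used for the column index. The (row, column) types are: (modal, modal) for $B$, (nodal, nodal) for $C$, (nodal, modal) for $E$, (modal, nodal) for $F$. The product $\vartheta_1\times\vartheta_2$ is admissible if the pair $\tau_{\vartheta_1},\tau_{\vartheta_2}$ is admissible. Approximate entries. With $s_0=(c'+d')/2$ the midpoint of $\tau_{\vartheta_2}=[c',d']$, set for $\nu\ge0$ $$h_\nu(t)=\frac{(-1)^\nu}{\nu!}\prod_{l=1}^{\nu}(1-\alpha-l+1)\,(t-s_0)^{1-\alpha-\nu},\qquad g_\nu(s)=(s-s_0)^\nu$$ (empty product $=1$, $g_0\equiv1$), and $$Q^p_{i\nu}=\frac{1}{\Gamma(2-\alpha)}\int_{x_{i-1}}^{x_i}h_\nu(t)(\phi_i^p)'(t)\,dt,\qquad W^q_{j\nu}=\int_{x_{j-1}}^{x_j}g_\nu(s)(\phi_j^q)'(s)\,ds,$$ $$\bar Q_{i\nu}=\frac{1}{\Gamma(2-\alpha)}\int_{x_{i-1}}^{x_{i+1}}h_\nu(t)\varphi_i'(t)\,dt,\qquad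 \bar W_{j\nu}=\int_{x_{j-1}}^{x_{j+1}}g_\nu(s)\varphi_j'(s)\,ds.$$ The rank-$R$ approximations are $$\tilde B_{ij}^{pq}=\sum_{\nu=0}^{R-1}Q^p_{i\nu}W^q_{j\nu},\quad \tilde C_{ij}=\sum_{\nu=0}^{R-1}\bar Q_{i\nu}\bar W_{j\nu},\quad \tilde E_{ij}^{q}=\sum_{\nu=0}^{R-1}\bar Q_{i\nu}W^q_{j\nu},\quad \tilde F_{ij}^{p}=\sum_{\nu=0}^{R-1}Q^p_{i\nu}\bar W_{j\nu}.$$ *)

(* Defs.v *)
From Stdlib Require Export Reals List Factorial.
From Coquelicot Require Export Coquelicot.
Open Scope R_scope.

(* Stdlib's [R] with Coquelicot's total [Derive], [RInt], [RInt_gen]. *)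

Definition Gamma (z : R) : R :=
  RInt_gen (fun t => Rpower t (z - 1) * exp (- t))
           (at_right 0) (Rbar_locally p_infty).

Definition is_partition (a b : R) (N : nat) (x : nat -> R) : Prop :=
  (1 <= N)%nat /\ x 0%nat = a /\ x N = b /\
  (forall i : nat, (1 <= i <= N)%nat -> x (i - 1)%nat < x i).

Definition mesh_size (x : nat -> R) (i : nat) : R := x i - x (i - 1)%nat.

(* Bonnet's recursion
   (m+1) L_{m+1}(t) = (2m+1) t L_m(t) - m L_{m-1}(t),  L_0 = 1,  L_1(t) = t. *)
Fixpoint legendre (p : nat) (t : R) : R :=
  match p with
  | O => 1
  | S m =>
    match m with
    | O => t
    | S m' => ((2 * INR m + 1) * t * legendre m t - INR m * legendre m' t)
              / (INR m + 1)
    end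
  end.

Definition psi (p : nat) (t : R) : R :=
  legendre (p - 1) t - legendre (p + 1) t.

(* Basis functions live on [a,b]; here they are extended by 0 to all of R. *)
Definition nodal (x : nat -> R) (j : nat) (t : R) : R :=
  if Rle_dec (x (j - 1)%nat) t then
    if Rle_dec t (x j) then (t - x (j - 1)%nat) / (x j - x (j - 1)%nat)
    else if Rle_dec t (x (j + 1)%nat) then
      (x (j + 1)%nat - t) / (x (j + 1)%nat - x j)
    else 0
  else 0.

Definition modal (x : nat -> R) (i p : nat) (t : R) : R :=
  if Rle_dec (x (i - 1)%nat) t then
    if Rle_dec t (x i) then
      psi p ((2 * t - (x (i - 1)%nat + x i)) / (x i - x (i - 1)%nat))
    else 0
  else 0.

(* The support: the closure of the set where f does not vanish. *)
Definition supp (f : R -> R) (t : R) : Prop :=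
  forall eps : R, 0 < eps -> exists y : R, Rabs (y - t) < eps /\ f y <> 0.

(* Integral over the support of f, meant for f whose support is a compact
   interval: [x_(j-1), x_(j+1)] for nodal, [x_(i-1), x_i] for modal. *)
Definition RInt_supp (f w : R -> R) : R :=
  RInt w (real (Glb_Rbar (supp f))) (real (Lub_Rbar (supp f))).

(* [Derive] coincides with the piecewise derivative away from the finitely many
   mesh points, where the value does not affect the integrals. [Rpower] is
   the real power only for a positive base, i.e. for supp u left of supp v. *)
Definition stiffness (alpha : R) (v u : R -> R) : R :=
  / Gamma (2 - alpha) *
  RInt_supp v (fun t =>
    Derive v t *
    RInt_supp u (fun s => Rpower (t - s) (1 - alpha) * Derive u s)).

Definition entryB (alpha : R) (x : nat -> R) (i j p q : nat) : R :=
  stiffness alpha (modal x i p) (modal x j q).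
Definition entryC (alpha : R) (x : nat -> R) (i j : nat) : R :=
  stiffness alpha (nodal x i) (nodal x j).
Definition entryE (alpha : R) (x : nat -> R) (i j q : nat) : R :=
  stiffness alpha (nodal x i) (modal x j q).
Definition entryF (alpha : R) (x : nat -> R) (i j p : nat) : R :=
  stiffness alpha (modal x i p) (nodal x j).

Definition diam (A : R -> Prop) : R :=
  real (Lub_Rbar (fun r => exists y z : R, A y /\ A z /\ r = Rabs (y - z))).

Definition dist_set (A B : R -> Prop) : R :=
  real (Glb_Rbar (fun r => exists y z : R, A y /\ B z /\ r = Rabs (y - z))).

Definition admissible (lambda : R) (tau sigma : R -> Prop) : Prop :=
  Rmax (diam sigma) (diam tau) <= lambda * dist_set tau sigma.

(* An index i with P i = 1 carries no modal function and contributes nothing. *)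
Definition tau_modal (x : nat -> R) (P : nat -> nat) (theta : nat -> Prop)
    (t : R) : Prop :=
  exists i p : nat, theta i /\ (1 <= p <= P i - 1)%nat /\ supp (modal x i p) t.

Definition tau_nodal (x : nat -> R) (theta : nat -> Prop) (t : R) : Prop :=
  exists i : nat, theta i /\ supp (nodal x i) t.

Definition is_interval (A : R -> Prop) (l r : R) : Prop :=
  forall t : R, A t <-> l <= t <= r.

Definition hfun (alpha s0 : R) (nu : nat) (t : R) : R :=
  (-1) ^ nu / INR (fact nu)
  * fold_right Rmult 1 (map (fun l => 1 - alpha - INR l + 1) (seq 1 nu))
  * Rpower (t - s0) (1 - alpha - INR nu).

Definition gfun (s0 : R) (nu : nat) (s : R) : R := (s - s0) ^ nu.

Definition Qmodal (alpha : R) (x : nat -> R) (s0 : R) (i p nu : nat) : R :=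
  / Gamma (2 - alpha) *
  RInt (fun t => hfun alpha s0 nu t * Derive (modal x i p) t)
       (x (i - 1)%nat) (x i).

Definition Wmodal (x : nat -> R) (s0 : R) (j q nu : nat) : R :=
  RInt (fun s => gfun s0 nu s * Derive (modal x j q) s) (x (j - 1)%nat) (x j).

Definition Qnodal (alpha : R) (x : nat -> R) (s0 : R) (i nu : nat) : R :=
  / Gamma (2 - alpha) *
  RInt (fun t => hfun alpha s0 nu t * Derive (nodal x i) t)
       (x (i - 1)%nat) (x (i + 1)%nat).

Definition Wnodal (x : nat -> R) (s0 : R) (j nu : nat) : R :=
  RInt (fun s => gfun s0 nu s * Derive (nodal x j) s)
       (x (j - 1)%nat) (x (j + 1)%nat).

(* f 0 + ... + f (n-1), with n terms (empty for n = 0) *)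
Definition sum_below (n : nat) (f : nat -> R) : R :=
  fold_right Rplus 0 (map f (seq 0 n)).

Definition approxB (alpha : R) (x : nat -> R) (s0 : R) (rk i j p q : nat) : R :=
  sum_below rk (fun nu => Qmodal alpha x s0 i p nu * Wmodal x s0 j q nu).
Definition approxC (alpha : R) (x : nat -> R) (s0 : R) (rk i j : nat) : R :=
  sum_below rk (fun nu => Qnodal alpha x s0 i nu * Wnodal x s0 j nu).
Definition approxE (alpha : R) (x : nat -> R) (s0 : R) (rk i j q : nat) : R :=
  sum_below rk (fun nu => Qnodal alpha x s0 i nu * Wmodal x s0 j q nu).
Definition approxF (alpha : R) (x : nat -> R) (s0 : R) (rk i j p : nat) : R :=
  sum_below rk (fun nu => Qmodal alpha x s0 i p nu * Wnodal x s0 j nu).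

(* Main.v *)
Require Import Defs.
From Stdlib Require Import Reals List Lra Lia.
From Coquelicot Require Import Coquelicot.
Open Scope R_scope.

(* The kernel expands as [(t-s)^(1-alpha) = sum_nu h_nu(t) g_nu(s)], uniformly on
   [supp v] x [supp u], so an exact entry is the limit of its rank-n approximations
   and the error is the tail [sum_(nu >= R) Q_nu W_nu]. Both factors are integrated
   by parts: [|Q_nu|] is at most [(nu+1) D^(-alpha-nu)] times [int |v|], with
   [D = a' - s0], and, since [g_nu] has total variation at most [2 rho^nu] on
   [[c', d']], [rho = d' - s0], [|W_nu| <= 2 rho^nu sup |u|]. Admissibility gives
   [rho / D <= delta], and [sum_(nu >= R) (nu+1) delta^nu] sums to
   [delta^R (1 + lambda/2) (R + 1 + lambda/2)].
   Only [sup |psi_q|] enters: [int |psi_q'|] is not bounded uniformly in [q]. *)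

(** * Legendre polynomials *)

(** The proof has a qualitative and a quantitative half. To pass to the limit, the truncated kernel
    is compared with the exact one pointwise, using suprema of [v'] and [u'] that may grow with the
    degree; they only multiply a remainder tending to 0. The rate is then read off term by term from
    the moments, where integration by parts has removed these derivatives. Its boundary terms vanish
    because every basis function is continuous and zero at both ends of its support. Origin of the
    constants: admissibility gives [2 rho <= lambda dist], and [D = dist + rho], so [rho / D] is at
    most [(lambda/2) / (1 + lambda/2) = lambda / (2 + lambda)]. The weight [nu + 1] is the cost of
    differentiating [h_nu]. The factors 8, 1, 2, 4 all come from [2 U V], with [U] a bound for the
    column function (2 modal, 1 nodal) and [V] the integral of a majorant of the row function
    ([2 h_i] modal, [(h_i + h_(i+1)) / 2] nodal). The modal bound 2 is [|L_(p-1)| + |L_(p+1)|] with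
    [|L_n| <= 1] on [-1,1]. *)

Fixpoint dlegendre (n : nat) (t : R) : R :=
  match n with
  | O => 0
  | S m => t * dlegendre m t + INR (S m) * legendre m t
  end.

Lemma legendre_SS (n : nat) (t : R) :
  legendre (S (S n)) t =
  ((2 * INR (S n) + 1) * t * legendre (S n) t - INR (S n) * legendre n t)
  / (INR (S n) + 1).
Proof. reflexivity. Qed.

(** [dlegendre] takes the classical identity [L'_(n+1) = t L'_n + (n+1) L_n] as its definition; this
    is the companion identity, proved algebraically from Bonnet's recursion before [dlegendre] is
    known to be a derivative. Together they relate the derivatives of neighbouring degrees, which
    yields both the differential equation and the derivative of [psi]. *)
Lemma dlegendre_down (n : nat) (t : R) :
  t * dlegendre (S n) t - dlegendre n t = INR (S n) * legendre (S n) t.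
Proof.
  induction n as [|n IH].
  - simpl; ring.
  - assert (Hn := pos_INR n).
    replace (INR (S (S n)) * legendre (S (S n)) t) with
      ((2 * INR (S n) + 1) * t * legendre (S n) t - INR (S n) * legendre n t).
    + change (dlegendre (S (S n)) t) with
        (t * dlegendre (S n) t + INR (S (S n)) * legendre (S n) t).
      assert (E : dlegendre (S n) t = t * dlegendre n t + INR (S n) * legendre n t)
        by reflexivity.
      assert (E2 : t * (t * dlegendre (S n) t)
        = t * (dlegendre n t + INR (S n) * legendre (S n) t)) by (rewrite <- IH; ring).
      rewrite (S_INR (S n)).
      set (A := legendre (S n) t) in *.
      rewrite Rmult_plus_distr_l, E2, E; ring.
    + rewrite legendre_SS, (S_INR (S n)), (S_INR n); field; lra.
Qed.

Lemma is_derive_eq (f : R -> R) (t l l' : R) :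
  is_derive f t l -> l = l' -> is_derive f t l'.
Proof. now intros H <-. Qed.

Lemma is_derive_legendre (n : nat) (t : R) :
  is_derive (legendre n) t (dlegendre n t).
Proof.
  enough (H : is_derive (legendre n) t (dlegendre n t) /\
              is_derive (legendre (S n)) t (dlegendre (S n) t)) by apply H.
  induction n as [|n [IH1 IH2]].
  - split; [apply (is_derive_const (1 : R))|].
    replace (dlegendre 1 t) with 1 by (simpl; ring).
    apply (is_derive_id t).
  - split; [exact IH2|].
    assert (Hn := pos_INR n).
    apply is_derive_ext with (f := fun t =>
      ((2 * INR (S n) + 1) * t * legendre (S n) t - INR (S n) * legendre n t)
      / (INR (S n) + 1)); [intros; now rewrite legendre_SS|].
    set (L1 := legendre (S n)) in *; set (L0 := legendre n) in *.
    set (k := INR (S n)).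
    apply (is_derive_eq _ _ (((2 * k + 1) * (L1 t + t * dlegendre (S n) t)
      - k * dlegendre n t) / (k + 1))).
    + clearbody L1 L0 k; auto_derive.
      * repeat split; eexists; eassumption.
      * replace (Derive (fun x => L1 x) t) with (dlegendre (S n) t)
          by (symmetry; apply is_derive_unique; assumption).
        replace (Derive (fun x => L0 x) t) with (dlegendre n t)
          by (symmetry; apply is_derive_unique; assumption).
        unfold Rdiv; ring.
    + unfold k, L1, L0.
      change (dlegendre (S (S n)) t) with
        (t * dlegendre (S n) t + INR (S (S n)) * legendre (S n) t).
      (* Differentiating Bonnet's recursion leaves [L'_n], two degrees below; the companion identity
         trades it for [L'_(n+1)] and [L_(n+1)]. *)
      assert (B := dlegendre_down n t).
      replace (dlegendre n t) with
        (t * dlegendre (S n) t - INR (S n) * legendre (S n) t) by lra.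
      rewrite (S_INR (S n)), (S_INR n); field; lra.
Qed.

Lemma Derive_legendre (n : nat) (t : R) :
  Derive (fun y => legendre n y) t = dlegendre n t.
Proof. apply is_derive_unique, is_derive_legendre. Qed.

Lemma ex_derive_dlegendre (n : nat) (t : R) : ex_derive (dlegendre n) t.
Proof.
  induction n as [|n IH].
  - apply (ex_derive_const (0 : R)).
  - apply ex_derive_ext with
      (f := fun t => t * dlegendre n t + INR (S n) * legendre n t);
      [reflexivity|].
    auto_derive; repeat split; [exact IH|].
    eexists; apply is_derive_legendre.
Qed.

Lemma continuous_legendre (n : nat) (t : R) : continuous (legendre n) t.
Proof.
  apply (ex_derive_continuous (legendre n)).
  eexists; apply is_derive_legendre.
Qed.

Lemma legendre_1 (n : nat) : legendre n 1 = 1.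
Proof.
  enough (H : legendre n 1 = 1 /\ legendre (S n) 1 = 1) by apply H.
  induction n as [|n [IH1 IH2]]; [split; reflexivity|].
  split; [exact IH2|].
  rewrite legendre_SS, IH1, IH2, S_INR; assert (Hn := pos_INR n); field; lra.
Qed.

Lemma legendre_m1 (n : nat) : legendre n (-1) = (-1) ^ n.
Proof.
  enough (H : legendre n (-1) = (-1) ^ n /\ legendre (S n) (-1) = (-1) ^ (S n))
    by apply H.
  induction n as [|n [IH1 IH2]]; [split; simpl; ring|].
  split; [exact IH2|].
  rewrite legendre_SS, IH1, IH2, S_INR; simpl; assert (Hn := pos_INR n); field; lra.
Qed.

(** Both sides of [(1-t^2) L_n' = (n+1) (t L_n - L_(n+1))] are differentiated; the recursion
    defining [dlegendre] brings the right-hand derivative back to degree [n]. *)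
Lemma legendre_ode (n : nat) (t : R) :
  (1 - t ^ 2) * Derive (dlegendre n) t
  = 2 * t * dlegendre n t - INR n * INR (S n) * legendre n t.
Proof.
  assert (E : forall t, (1 - t ^ 2) * dlegendre n t
              = INR (S n) * (t * legendre n t - legendre (S n) t)).
  { intros y. assert (B := dlegendre_down n y).
    change (dlegendre (S n) y) with (y * dlegendre n y + INR (S n) * legendre n y) in B.
    lra. }
  assert (D1 : is_derive (fun t => (1 - t ^ 2) * dlegendre n t) t
     (- (2 * t) * dlegendre n t + (1 - t ^ 2) * Derive (dlegendre n) t)).
  { auto_derive; [exact (ex_derive_dlegendre n t)|].
    change (Derive (fun y => dlegendre n y) t) with (Derive (dlegendre n) t); ring. }
  assert (D2 : is_derive (fun t => (1 - t ^ 2) * dlegendre n t) t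
     (INR (S n) * (legendre n t + t * dlegendre n t - dlegendre (S n) t))).
  { apply (is_derive_ext _ _ t _ (fun y => eq_sym (E y))).
    generalize (is_derive_legendre n t) (is_derive_legendre (S n) t).
    generalize (legendre n) (legendre (S n)) (INR (S n)) (dlegendre n t)
      (dlegendre (S n) t); intros f g k df dg Hf Hg.
    auto_derive.
    - repeat split; eexists; eassumption.
    - replace (Derive (fun x => f x) t) with df
        by (symmetry; apply is_derive_unique; assumption).
      replace (Derive (fun x => g x) t) with dg
        by (symmetry; apply is_derive_unique; assumption).
      ring. }
  assert (Q := is_derive_unique _ _ _ D1).
  rewrite (is_derive_unique _ _ _ D2) in Q.
  change (dlegendre (S n) t) with (t * dlegendre n t + INR (S n) * legendre n t) in Q.
  rewrite S_INR in *. lra.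
Qed.

(* Sonin's function [n(n+1) L_n^2 + (1-t^2) L_n'^2] has derivative [2 t L_n'^2],
   so on [-1,1] it is largest at the end points. *)
Lemma legendre_bound (n : nat) (t : R) : -1 <= t <= 1 -> Rabs (legendre n t) <= 1.
Proof.
  intros Ht.
  destruct (Nat.eq_dec n 0) as [->|Hn]; [simpl; rewrite Rabs_R1; lra|].
  rename n into k.
  set (f := fun t => INR k * INR (S k) * legendre k t ^ 2
                     + (1 - t ^ 2) * dlegendre k t ^ 2).
  assert (Df : forall t, is_derive f t (2 * t * dlegendre k t ^ 2)).
  { intros y; unfold f.
    generalize (legendre_ode k y) (Derive_legendre k y) (ex_derive_dlegendre k y)
      (ex_intro _ _ (is_derive_legendre k y) : ex_derive (legendre k) y).
    generalize (legendre k) (dlegendre k) (INR k * INR (S k)).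
    intros g dg c O Hd Hdg Hg; auto_derive.
    - repeat split; assumption.
    - rewrite Hd. transitivity (2 * dg y * (c * g y + (1 - y ^ 2) * Derive dg y - y * dg y));
        [change (Derive (fun x => dg x) y) with (Derive dg y); ring|].
      rewrite O; ring. }
  assert (Hk : 0 < INR k * INR (S k)).
  { apply Rmult_lt_0_compat; apply lt_0_INR; lia. }
  assert (Hf : f t <= INR k * INR (S k)).
  { destruct (Rle_dec 0 t) as [H0|H0].
    - replace (INR k * INR (S k)) with (f 1)
        by (unfold f; rewrite legendre_1; ring).
      destruct (MVT_gen f t 1 (fun t => 2 * t * dlegendre k t ^ 2)) as [c [Hc E]].
      + intros; apply Df.
      + intros; apply continuity_pt_filterlim.
        apply (ex_derive_continuous f); eexists; apply Df.
      + rewrite Rmin_left, Rmax_right in Hc by lra.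
        assert (0 <= 2 * c * dlegendre k c ^ 2 * (1 - t)).
        { apply Rmult_le_pos; [|lra]. apply Rmult_le_pos; [lra|apply pow2_ge_0]. }
        lra.
    - replace (INR k * INR (S k)) with (f (-1)).
      2:{ unfold f; rewrite legendre_m1, <- pow_mult, Nat.mul_comm, pow_1_even. ring. }
      destruct (MVT_gen f (-1) t (fun t => 2 * t * dlegendre k t ^ 2)) as [c [Hc E]].
      + intros; apply Df.
      + intros; apply continuity_pt_filterlim.
        apply (ex_derive_continuous f); eexists; apply Df.
      + rewrite Rmin_left, Rmax_right in Hc by lra.
        assert (0 <= 2 * (- c) * dlegendre k c ^ 2 * (t - -1)).
        { apply Rmult_le_pos; [|lra]. apply Rmult_le_pos; [lra|apply pow2_ge_0]. }
        lra. }
  assert (H1 : 0 <= (1 - t ^ 2) * dlegendre k t ^ 2).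
  { apply Rmult_le_pos; [nra|apply pow2_ge_0]. }
  assert (H2 : legendre k t ^ 2 <= 1).
  { unfold f in Hf. apply Rmult_le_reg_l with (1 := Hk). lra. }
  apply Rabs_le; split; nra.
Qed.

Definition dpsi (p : nat) (t : R) : R := - (2 * INR p + 1) * legendre p t.

(** The two recursions give [L'_(p+1) = t L'_p + (p+1) L_p] and [L'_(p-1) = t L'_p - p L_p]; in the
    difference the derivatives cancel. *)
Lemma is_derive_psi (p : nat) (t : R) :
  (1 <= p)%nat -> is_derive (psi p) t (dpsi p t).
Proof.
  intros Hp. destruct p as [|p]; [lia|].
  replace (dpsi (S p) t) with (dlegendre p t - dlegendre (S (S p)) t).
  - unfold psi. replace (S p - 1)%nat with p by lia.
    replace (S p + 1)%nat with (S (S p)) by lia.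
    apply (is_derive_minus (legendre p) (legendre (S (S p)))); apply is_derive_legendre.
  - assert (B := dlegendre_down p t).
    change (dlegendre (S (S p)) t) with
      (t * dlegendre (S p) t + INR (S (S p)) * legendre (S p) t).
    unfold dpsi. rewrite (S_INR (S p)). lra.
Qed.

Lemma psi_bound (p : nat) (t : R) : -1 <= t <= 1 -> Rabs (psi p t) <= 2.
Proof.
  intros Ht; unfold psi.
  assert (H1 := legendre_bound (p - 1) t Ht).
  assert (H2 := legendre_bound (p + 1) t Ht).
  apply Rabs_le; apply Rabs_le_between in H1; apply Rabs_le_between in H2; lra.
Qed.

Lemma psi_1 (p : nat) : psi p 1 = 0.
Proof. unfold psi; rewrite 2!legendre_1; ring. Qed.

Lemma psi_m1 (p : nat) : (1 <= p)%nat -> psi p (-1) = 0.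
Proof.
  intros Hp; unfold psi; rewrite 2!legendre_m1.
  replace (p + 1)%nat with (p - 1 + 2)%nat by lia.
  rewrite pow_add; ring.
Qed.

(** Serves to identify the support: a simple zero at the end point makes [psi p] nonzero close to
    it, so that the end of the mesh cell belongs to the closed support. *)
Lemma dpsi_1 (p : nat) : dpsi p 1 <> 0.
Proof. unfold dpsi; rewrite legendre_1; assert (H := pos_INR p); lra. Qed.

Lemma dpsi_m1 (p : nat) : dpsi p (-1) <> 0.
Proof.
  unfold dpsi; rewrite legendre_m1; assert (H := pos_INR p).
  apply Rmult_integral_contrapositive; split; [lra|apply pow_nonzero; lra].
Qed.

(** * The binomial expansion of the kernel *)

Lemma is_derive_Rpower (x y : R) :
  0 < x -> is_derive (fun x => Rpower x y) x (y * Rpower x (y - 1)).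
Proof. intros Hx; apply is_derive_Reals, derivable_pt_lim_power, Hx. Qed.

Lemma Rpower_pos (x y : R) : 0 < Rpower x y.
Proof. apply exp_pos. Qed.

Lemma Rpower_nonpos_le (x y c : R) :
  0 < x <= y -> c <= 0 -> Rpower y c <= Rpower x c.
Proof.
  intros [H0 H1] Hc.
  replace c with (- (- c)) by ring; rewrite 2!(Rpower_Ropp _ (- c)).
  apply Rinv_le_contravar; [apply Rpower_pos|].
  apply Rle_Rpower_l; [lra|split; assumption].
Qed.

Lemma Rpower_minus_nat (x y : R) (n : nat) :
  0 < x -> Rpower x (y - INR n) = Rpower x y * (/ x) ^ n.
Proof.
  intros Hx; unfold Rminus; rewrite Rpower_plus, Rpower_Ropp, Rpower_pow by assumption.
  now rewrite pow_inv.
Qed.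

Lemma sum_below_S (n : nat) (f : nat -> R) :
  sum_below (S n) f = sum_below n f + f n.
Proof.
  unfold sum_below; rewrite seq_S, map_app, fold_right_app; simpl.
  rewrite Rplus_0_r.
  generalize (f n); induction (map f (seq 0 n)) as [|y l IH]; intros c; simpl.
  - ring.
  - rewrite IH; ring.
Qed.

Lemma sum_below_ext (n : nat) (f g : nat -> R) :
  (forall k, f k = g k) -> sum_below n f = sum_below n g.
Proof. intros H; unfold sum_below; now rewrite (map_ext f g H). Qed.

Lemma sum_below_scal (n : nat) (c : R) (f : nat -> R) :
  sum_below n (fun k => c * f k) = c * sum_below n f.
Proof.
  induction n as [|n IH]; [unfold sum_below; simpl; ring|].
  rewrite 2!sum_below_S, IH; ring.
Qed.

(* Taylor coefficients of [(1 - w)^(1 - alpha)] at [0]. *)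
Fixpoint bincoef (alpha : R) (n : nat) : R :=
  match n with
  | O => 1
  | S m => bincoef alpha m * (alpha - 1 + INR m) / INR (S m)
  end.

(** Each factor [(alpha - 1 + m) / (m + 1)] of the recursion lies in [0,1] because
    [0 <= alpha - 1 <= 1]. *)
Lemma bincoef_bound (alpha : R) (n : nat) :
  1 <= alpha <= 2 -> 0 <= bincoef alpha n <= 1.
Proof.
  intros Ha; induction n as [|n IH]; [simpl; lra|].
  change (bincoef alpha (S n))
    with (bincoef alpha n * (alpha - 1 + INR n) / INR (S n)).
  rewrite S_INR; assert (Hn := pos_INR n).
  split.
  - apply Rmult_le_pos; [nra|]. left; apply Rinv_0_lt_compat; lra.
  - apply Rmult_le_reg_r with (INR n + 1); [lra|].
    unfold Rdiv; rewrite Rmult_assoc, Rinv_l by lra; nra.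
Qed.

(** Each factor [1 - alpha - l + 1] equals [- (alpha - 1 + (l - 1))], so [(-1)^nu] cancels all the
    signs. *)
Lemma hfun_bincoef (alpha s0 : R) (n : nat) (t : R) :
  hfun alpha s0 n t = bincoef alpha n * Rpower (t - s0) (1 - alpha - INR n).
Proof.
  unfold hfun; f_equal.
  induction n as [|n IH]; [simpl; field|].
  change (bincoef alpha (S n))
    with (bincoef alpha n * (alpha - 1 + INR n) / INR (S n)).
  rewrite <- IH, seq_S, map_app, fold_right_app.
  change (1 + n)%nat with (S n); simpl map; simpl fold_right at 1.
  (* The new factor is the last of the list, hence sits in the initial value of the fold and has to
     be pulled out. *)
  assert (E : forall l c, fold_right Rmult c l = fold_right Rmult 1 l * c).
  { intros l c; induction l as [|y l IHl]; simpl; [ring|rewrite IHl; ring]. }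
  rewrite E, fact_simpl, mult_INR, Rmult_1_r.
  change ((-1) ^ S n) with (-1 * (-1) ^ n).
  change (match n with 0%nat => 1 | S _ => INR n + 1 end) with (INR (S n)).
  assert (INR (S n) <> 0) by (apply not_0_INR; lia).
  assert (HS := S_INR n).
  assert (INR (fact n) <> 0) by apply INR_fact_neq_0.
  replace (1 - alpha - INR (S n) + 1) with (- (alpha - 1 + INR n)) by lra.
  field; split; assumption.
Qed.

Definition dhfun (alpha s0 : R) (nu : nat) (t : R) : R :=
  bincoef alpha nu * ((1 - alpha - INR nu) * Rpower (t - s0) (- alpha - INR nu)).

Lemma is_derive_hfun (alpha s0 : R) (nu : nat) (t : R) :
  s0 < t -> is_derive (hfun alpha s0 nu) t (dhfun alpha s0 nu t).
Proof.
  intros Ht.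
  apply is_derive_ext with
    (f := fun t => bincoef alpha nu * Rpower (t - s0) (1 - alpha - INR nu));
    [intros y; symmetry; apply hfun_bincoef|].
  apply is_derive_scal.
  apply is_derive_eq with
    (1 * ((1 - alpha - INR nu) * Rpower (t - s0) (1 - alpha - INR nu - 1))).
  - apply (is_derive_comp (fun x => Rpower x (1 - alpha - INR nu)) (fun t => t - s0)).
    + apply is_derive_Rpower; lra.
    + auto_derive; [trivial|ring].
  - rewrite Rmult_1_l; do 2 f_equal; ring.
Qed.

Lemma continuous_Rpower (t e : R) : 0 < t -> continuous (fun t => Rpower t e) t.
Proof.
  intros Ht; apply (ex_derive_continuous (fun t => Rpower t e)).
  eexists; apply is_derive_Rpower, Ht.
Qed.

Lemma continuous_dhfun (alpha s0 : R) (nu : nat) (t : R) :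
  s0 < t -> continuous (dhfun alpha s0 nu) t.
Proof.
  intros Ht; unfold dhfun.
  apply (continuous_scal_r (bincoef alpha nu)
    (fun t => (1 - alpha - INR nu) * Rpower (t - s0) (- alpha - INR nu))).
  apply (continuous_scal_r (1 - alpha - INR nu)
    (fun t => Rpower (t - s0) (- alpha - INR nu))).
  apply (continuous_comp (fun t => t - s0) (fun y => Rpower y (- alpha - INR nu))).
  - apply (continuous_minus (fun t => t) (fun _ => s0));
      [apply continuous_id|apply continuous_const].
  - apply continuous_Rpower; lra.
Qed.

(** The weight [nu + 1] arises here: [|1 - alpha - nu| <= nu + 1] since [alpha <= 2], while the
    coefficient is at most 1 and the negative power is largest at the smallest distance [D]. *)
Lemma dhfun_bound (alpha s0 D : R) (nu : nat) (t : R) :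
  1 <= alpha <= 2 -> 0 < D -> D <= t - s0 ->
  Rabs (dhfun alpha s0 nu t)
  <= (INR nu + 1) * (Rpower D (- alpha) * (/ D) ^ nu).
Proof.
  intros Ha HD Ht; unfold dhfun.
  assert (Hc := bincoef_bound alpha nu Ha); assert (Hn := pos_INR nu).
  rewrite <- Rpower_minus_nat by assumption.
  rewrite 2!Rabs_mult, (Rabs_pos_eq (bincoef _ _)) by apply Hc.
  rewrite (Rabs_pos_eq (Rpower _ _)) by (left; apply Rpower_pos).
  rewrite <- (Rmult_1_l (_ * Rpower D _)).
  apply Rmult_le_compat; [apply Hc| |apply Hc|].
  { apply Rmult_le_pos; [apply Rabs_pos|left; apply Rpower_pos]. }
  apply Rmult_le_compat; [apply Rabs_pos|left; apply Rpower_pos| |].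
  - apply Rabs_le; lra.
  - apply Rpower_nonpos_le; lra.
Qed.

(** Takes the place of a Taylor remainder formula. With [S_n] the partial sum, the recursion
    [(k+1) c_(k+1) = (alpha-1+k) c_k] makes [(1-w) S_n' - (alpha-1) S_n] telescope to its top term,
    so only one monomial survives in the derivative. *)
Lemma bincoef_partial_sum (alpha : R) (n : nat) (w : R) :
  w < 1 ->
  is_derive
    (fun w => Rpower (1 - w) (alpha - 1)
              * sum_below n (fun k => bincoef alpha k * w ^ k)) w
    (- (Rpower (1 - w) (alpha - 2) * (INR n * bincoef alpha n * w ^ (n - 1)))).
Proof.
  intros Hw.
  assert (DP : is_derive (fun w => Rpower (1 - w) (alpha - 1)) w
                 (- ((alpha - 1) * Rpower (1 - w) (alpha - 2)))).
  { apply is_derive_eq with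
      (-1 * ((alpha - 1) * Rpower (1 - w) (alpha - 1 - 1))).
    - apply (is_derive_comp (fun x => Rpower x (alpha - 1)) (fun t => 1 - t)).
      + apply is_derive_Rpower; lra.
      + auto_derive; [trivial|ring].
    - replace (alpha - 1 - 1) with (alpha - 2) by ring; ring. }
  assert (DS : exists d,
    is_derive (fun w => sum_below n (fun k => bincoef alpha k * w ^ k)) w d /\
    (1 - w) * d - (alpha - 1) * sum_below n (fun k => bincoef alpha k * w ^ k)
    = - (INR n * bincoef alpha n * w ^ (n - 1))).
  { induction n as [|n [d [Hd E]]].
    - exists 0; split; [apply (is_derive_const 0)|unfold sum_below; simpl; ring].
    - exists (d + bincoef alpha n * (INR n * w ^ (n - 1))); split.
      + apply is_derive_ext with
          (f := fun w => sum_below n (fun k => bincoef alpha k * w ^ k)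
                         + bincoef alpha n * w ^ n);
          [intros; now rewrite sum_below_S|].
        apply (is_derive_plus
          (fun w => sum_below n (fun k => bincoef alpha k * w ^ k))
          (fun w => bincoef alpha n * w ^ n)); [exact Hd|].
        auto_derive; [trivial|]. rewrite <- Nat.sub_1_r; ring.
      + rewrite sum_below_S.
        change (bincoef alpha (S n))
          with (bincoef alpha n * (alpha - 1 + INR n) / INR (S n)).
        replace (S n - 1)%nat with n by lia.
        replace (INR (S n) * (bincoef alpha n * (alpha - 1 + INR n) / INR (S n)))
          with (bincoef alpha n * (alpha - 1 + INR n))
          by (field; apply not_0_INR; lia).
        (* The factor [INR n] covers [n = 0], where [n - 1] truncates to 0 and the powers alone
           would differ. *)
        assert (P : INR n * w ^ n = INR n * (w * w ^ (n - 1))).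
        { destruct n as [|n]; [simpl; ring|].
          replace (S n - 1)%nat with n by lia; simpl; ring. }
        apply Rminus_diag_uniq.
        transitivity (((1 - w) * d
          - (alpha - 1) * sum_below n (fun k => bincoef alpha k * w ^ k)
          + INR n * bincoef alpha n * w ^ (n - 1))
          + bincoef alpha n * (INR n * w ^ n - INR n * (w * w ^ (n - 1))));
          [ring|rewrite E, P; ring]. }
  destruct DS as [d [Hd E]].
  apply is_derive_eq with
    (- ((alpha - 1) * Rpower (1 - w) (alpha - 2))
       * sum_below n (fun k => bincoef alpha k * w ^ k)
     + Rpower (1 - w) (alpha - 1) * d).
  - apply (is_derive_mult _ _ w _ _ DP Hd). intros; apply Rmult_comm.
  - replace (Rpower (1 - w) (alpha - 1)) with (Rpower (1 - w) (alpha - 2) * (1 - w)).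
    + transitivity (Rpower (1 - w) (alpha - 2) * ((1 - w) * d
        - (alpha - 1) * sum_below n (fun k => bincoef alpha k * w ^ k)));
        [ring|rewrite E; ring].
    + replace (alpha - 1) with (alpha - 2 + 1) by ring.
      rewrite Rpower_plus, (Rpower_1 (1 - w)) by lra; reflexivity.
Qed.

(** The product equals 1 at [w = 0], so the mean value theorem bounds its distance from 1. The
    factor [n] in the bound is harmless, since it serves only to show convergence to 0. *)
Lemma bincoef_remainder (alpha d : R) (n : nat) (w : R) :
  1 <= alpha <= 2 -> d < 1 -> Rabs w <= d ->
  Rabs (1 - Rpower (1 - w) (alpha - 1)
            * sum_below n (fun k => bincoef alpha k * w ^ k))
  <= Rpower (1 - d) (alpha - 2) * (INR n * d ^ n) + d ^ n.
Proof.
  intros Ha Hd Hw.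
  assert (0 <= d) by (generalize (Rabs_pos w); lra).
  destruct n as [|n].
  (* With no terms the left side is 1; the summand [d ^ n] of the bound is there for this case. *)
  { unfold sum_below; simpl. rewrite Rmult_0_r, Rminus_0_r, Rabs_R1. lra. }
  set (f := fun w => Rpower (1 - w) (alpha - 1)
              * sum_below (S n) (fun k => bincoef alpha k * w ^ k)).
  apply Rabs_le_between in Hw.
  assert (Hc : forall c, Rmin 0 w <= c <= Rmax 0 w -> Rabs c <= d).
  { intros c; unfold Rmin, Rmax; destruct (Rle_dec 0 w); intros; apply Rabs_le; lra. }
  destruct (MVT_gen f 0 w (fun w => - (Rpower (1 - w) (alpha - 2)
    * (INR (S n) * bincoef alpha (S n) * w ^ (S n - 1))))) as [c [C E]].
  - intros c C; apply bincoef_partial_sum.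
    assert (A : Rabs c <= d) by (apply Hc; lra); apply Rabs_le_between in A; lra.
  - intros c C; apply continuity_pt_filterlim, (ex_derive_continuous f).
    eexists; apply bincoef_partial_sum.
    apply Hc in C; apply Rabs_le_between in C; lra.
  - assert (F0 : f 0 = 1).
    { unfold f; rewrite Rminus_0_r; unfold Rpower at 1.
      rewrite ln_1, Rmult_0_r, exp_0, Rmult_1_l.
      clear. induction n as [|n IH]; [unfold sum_below; simpl; ring|].
      rewrite sum_below_S, IH, pow_i by lia; ring. }
    rewrite F0 in E. apply Hc in C.
    change (Rabs (1 - f w) <= Rpower (1 - d) (alpha - 2) * (INR (S n) * d ^ S n)
                              + d ^ S n).
    replace (1 - f w) with (- (f w - 1)) by ring; rewrite Rabs_Ropp, E.
    replace (S n - 1)%nat with n by lia.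
    assert (B := bincoef_bound alpha (S n) Ha); assert (I := pos_INR (S n)).
    rewrite Rabs_mult, Rabs_Ropp, !Rabs_mult, Rminus_0_r.
    rewrite (Rabs_pos_eq (Rpower _ _)) by (left; apply Rpower_pos).
    rewrite (Rabs_pos_eq (INR _)), (Rabs_pos_eq (bincoef _ _)) by lra.
    rewrite <- RPow_abs.
    assert (P1 : Rpower (1 - c) (alpha - 2) <= Rpower (1 - d) (alpha - 2)).
    { apply Rpower_nonpos_le; [|lra]. apply Rabs_le_between in C; lra. }
    assert (P2 : Rabs c ^ n <= d ^ n) by (apply pow_incr; split; [apply Rabs_pos|lra]).
    assert (P3 : Rabs w <= d) by (apply Rabs_le; lra).
    assert (P4 : 0 <= d ^ n) by (apply pow_le; lra).
    assert (P5 : 0 <= Rabs c ^ n) by (apply pow_le, Rabs_pos).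
    assert (P6 := Rpower_pos (1 - c) (alpha - 2)).
    assert (Q : INR (S n) * bincoef alpha (S n) * Rabs c ^ n <= INR (S n) * d ^ n).
    { rewrite Rmult_assoc; apply Rmult_le_compat_l; [lra|]. nra. }
    assert (Q0 : 0 <= INR (S n) * bincoef alpha (S n) * Rabs c ^ n).
    { apply Rmult_le_pos; [|assumption]. apply Rmult_le_pos; lra. }
    assert (P7 : 0 <= d ^ S n) by (apply pow_le; lra).
    apply Rle_trans with (Rpower (1 - d) (alpha - 2) * (INR (S n) * d ^ n) * d).
    + apply Rmult_le_compat; [|apply Rabs_pos| |exact P3].
      * apply Rmult_le_pos; lra.
      * apply Rmult_le_compat; lra.
    + change (d ^ S n) with (d * d ^ n) in *. lra.
Qed.

(** With [w = (s - s0) / (t - s0)] one has [t - s = (t - s0) (1 - w)]. Pulling out the whole kernel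
    [(t-s)^(1-alpha)] leaves exactly [1 - (1-w)^(alpha-1) S_n(w)], and the kernel itself is bounded
    because [t - s >= (1-d) D]. *)
Lemma kernel_remainder (alpha s0 D d : R) (n : nat) (t s : R) :
  1 <= alpha <= 2 -> 0 < D -> d < 1 -> D <= t - s0 -> Rabs (s - s0) <= d * D ->
  Rabs (Rpower (t - s) (1 - alpha)
        - sum_below n (fun k => hfun alpha s0 k t * gfun s0 k s))
  <= Rpower ((1 - d) * D) (1 - alpha)
     * (Rpower (1 - d) (alpha - 2) * (INR n * d ^ n) + d ^ n).
Proof.
  intros Ha HD Hd Ht Hs.
  set (z := t - s0) in *; set (y := s - s0) in *; set (w := y / z).
  assert (Hz : 0 < z) by lra.
  assert (Hd0 : 0 <= d).
  { apply Rmult_le_reg_r with D; [lra|]. generalize (Rabs_pos y); lra. }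
  assert (Hw : Rabs w <= d).
  { unfold w, Rdiv; rewrite Rabs_mult, Rabs_inv, (Rabs_pos_eq z) by lra.
    apply Rmult_le_reg_r with z; [lra|].
    rewrite Rmult_assoc, Rinv_l, Rmult_1_r by lra. nra. }
  assert (Hw1 : w < 1) by (apply Rabs_le_between in Hw; lra).
  assert (Hts : t - s = z * (1 - w)) by (unfold w, z, y; field; unfold z in Hz; lra).
  assert (HzD : (1 - d) * D <= t - s).
  { rewrite Hts; apply Rabs_le_between in Hw. nra. }
  assert (0 < (1 - d) * D) by (apply Rmult_lt_0_compat; lra).
  replace (Rpower (t - s) (1 - alpha)
        - sum_below n (fun k => hfun alpha s0 k t * gfun s0 k s)) with
    (Rpower (t - s) (1 - alpha) * (1 - Rpower (1 - w) (alpha - 1)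
            * sum_below n (fun k => bincoef alpha k * w ^ k))).
  - rewrite Rabs_mult, (Rabs_pos_eq (Rpower _ _)) by (left; apply Rpower_pos).
    apply Rmult_le_compat; [left; apply Rpower_pos|apply Rabs_pos| |].
    + apply Rpower_nonpos_le; lra.
    + apply bincoef_remainder; assumption.
  - rewrite Rmult_minus_distr_l, Rmult_1_r; f_equal.
    rewrite (sum_below_ext n (fun k => hfun alpha s0 k t * gfun s0 k s)
      (fun k => Rpower z (1 - alpha) * (bincoef alpha k * w ^ k))).
    + rewrite sum_below_scal, <- Rmult_assoc; f_equal.
      rewrite Hts, <- Rpower_mult_distr, Rmult_assoc, <- Rpower_plus by lra.
      replace (1 - alpha + (alpha - 1)) with 0 by ring.
      rewrite Rpower_O by lra; ring.
    + intros k; rewrite hfun_bincoef; unfold gfun; fold z y.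
      rewrite Rpower_minus_nat by assumption.
      unfold w, Rdiv; rewrite Rpow_mult_distr; ring.
Qed.

(** With [d = q^2], one factor [q^n] keeps [n q^n] below [1 / (1-q)], as
    [n q^n <= 1 + q + ... + q^(n-1)], and the other one tends to 0. *)
Lemma is_lim_seq_INR_pow (d : R) :
  0 <= d < 1 -> is_lim_seq (fun n => INR n * d ^ n) 0.
Proof.
  intros Hd; set (q := sqrt d).
  assert (Hq : 0 <= q < 1).
  { split; [apply sqrt_pos|]. rewrite <- sqrt_1; apply sqrt_lt_1; lra. }
  assert (Hb : forall n, INR n * q ^ n <= / (1 - q)).
  { intros n.
    assert (INR n * q ^ n * (1 - q) <= 1 - q ^ n).
    { induction n as [|n IH]; [simpl; lra|].
      rewrite S_INR; simpl pow.
      assert (0 <= q ^ n) by (apply pow_le; lra).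
      assert (q * (INR n * q ^ n * (1 - q)) <= q * (1 - q ^ n))
        by (apply Rmult_le_compat_l; lra).
      assert (q ^ n <= 1) by (rewrite <- (pow1 n); apply pow_incr; lra).
      assert (0 <= (1 - q) * (1 - q * q ^ n)) by (apply Rmult_le_pos; nra).
      lra. }
    assert (0 <= q ^ n) by (apply pow_le; lra).
    apply Rmult_le_reg_r with (1 - q); [lra|]. rewrite Rinv_l; lra. }
  apply is_lim_seq_le_le with (u := fun _ => 0) (w := fun n => / (1 - q) * q ^ n).
  - intros n.
    assert (0 <= q ^ n) by (apply pow_le; lra).
    replace (d ^ n) with (q ^ n * q ^ n)
      by (rewrite <- Rpow_mult_distr; unfold q; rewrite sqrt_sqrt; lra).
    rewrite <- Rmult_assoc.
    split; [|apply Rmult_le_compat_r; auto].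
    apply Rmult_le_pos; [|assumption].
    apply Rmult_le_pos; [apply pos_INR|assumption].
  - apply is_lim_seq_const.
  - replace (Finite 0) with (Rbar_mult (/ (1 - q)) 0) by (simpl; f_equal; ring).
    apply is_lim_seq_scal_l, is_lim_seq_geom. rewrite Rabs_pos_eq; lra.
Qed.

(* Telescoping: [F n = d^n b (n + 1 + l/2)] with [b = 1 + l/2 = 1/(1-d)] satisfies
   [F n - F (n+1) = (n+1) d^n]. *)
Lemma arith_geom_tail (l : R) (f : nat -> R) (C : R) (n m : nat) :
  0 < l -> 0 <= C ->
  (forall k, Rabs (f k) <= C * ((INR k + 1) * (l / (2 + l)) ^ k)) ->
  (n <= m)%nat ->
  Rabs (sum_below m f - sum_below n f)
  <= C * ((1 + l / 2) * (INR n + 1 + l / 2) * (l / (2 + l)) ^ n).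
Proof.
  intros Hl HC Hf Hnm.
  set (d := l / (2 + l)) in *.
  set (F := fun n => (1 + l / 2) * (INR n + 1 + l / 2) * d ^ n).
  assert (Hd : 0 <= d).
  { unfold d, Rdiv; apply Rmult_le_pos; [lra|left; apply Rinv_0_lt_compat; lra]. }
  enough (Rabs (sum_below m f - sum_below n f) <= C * (F n - F m)).
  { apply Rle_trans with (1 := H), Rmult_le_compat_l; [assumption|].
    fold (F n). enough (0 <= F m) by lra.
    unfold F; apply Rmult_le_pos; [|apply pow_le, Hd].
    generalize (pos_INR m); intros; apply Rmult_le_pos; lra. }
  induction Hnm as [|m Hnm IH].
  - rewrite 2!Rminus_diag, Rabs_R0; lra.
  - rewrite sum_below_S.
    replace (_ + f m - _) with ((sum_below m f - sum_below n f) + f m) by ring.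
    apply Rle_trans with (1 := Rabs_triang _ _).
    replace (F n - F (S m)) with ((F n - F m) + (INR m + 1) * d ^ m).
    + rewrite Rmult_plus_distr_l. apply Rplus_le_compat; [exact IH|apply Hf].
    + unfold F; rewrite S_INR; simpl pow.
      assert (Hbd : (1 + l / 2) * d = l / 2) by (unfold d; field; lra).
      replace ((1 + l / 2) * (INR m + 1 + 1 + l / 2) * (d * d ^ m))
        with ((INR m + 1 + 1 + l / 2) * ((1 + l / 2) * d) * d ^ m) by ring.
      rewrite Hbd; field.
Qed.

(** * Integration by parts against piecewise C1 functions *)

Definition C1 (w dw : R -> R) : Prop :=
  forall t, is_derive w t (dw t) /\ continuous dw t.

(** The pieces [w1], [w2] are C1 on the whole line, which avoids one-sided derivatives. They are
    compared with [v] on open intervals only: the values at [l], [m], [r] do not affect integrals,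
    and continuity and the zero boundary values are expressed through the pieces. *)
Definition hat_on (v : R -> R) (l r : R) : Prop :=
  exists (m : R) (w1 dw1 w2 dw2 : R -> R),
    l < m < r /\ C1 w1 dw1 /\ C1 w2 dw2 /\
    (forall t, l < t < m -> v t = w1 t) /\ (forall t, m < t < r -> v t = w2 t) /\
    w1 l = 0 /\ w1 m = w2 m /\ w2 r = 0.

Lemma Derive_piece (v w dw : R -> R) (l r t : R) :
  C1 w dw -> (forall t, l < t < r -> v t = w t) -> l < t < r -> Derive v t = dw t.
Proof.
  intros Hw Hv Ht; rewrite <- (is_derive_unique w t (dw t)) by apply Hw.
  apply Derive_ext_loc.
  apply (locally_interval _ t l r); simpl; try apply Ht.
  intros y Hl Hr; now apply Hv.
Qed.

Lemma ex_RInt_piece (v w : R -> R) (G : R -> R) (l r : R) :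
  l <= r -> (forall t, l < t < r -> v t = w t) ->
  (forall t, l <= t <= r -> continuous w t) ->
  (forall t, l <= t <= r -> continuous G t) ->
  ex_RInt (fun t => G t * v t) l r.
Proof.
  intros Hlr Hv Hw HG.
  apply ex_RInt_ext with (fun t => G t * w t).
  - rewrite Rmin_left, Rmax_right by assumption.
    intros t Ht; now rewrite Hv.
  - apply (ex_RInt_continuous (V := R_CompleteNormedModule)).
    rewrite Rmin_left, Rmax_right by assumption.
    intros t Ht; apply (continuous_mult G w); auto.
Qed.

Lemma C1_continuous (w dw : R -> R) (t : R) : C1 w dw -> continuous w t.
Proof.
  intros H; apply (ex_derive_continuous w); eexists; apply H.
Qed.

Lemma RInt_by_parts_piece (v w dw F dF : R -> R) (l r : R) :
  l <= r -> C1 w dw -> (forall t, l < t < r -> v t = w t) ->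
  (forall t, l <= t <= r -> is_derive F t (dF t)) ->
  (forall t, l <= t <= r -> continuous dF t) ->
  RInt (fun t => F t * Derive v t) l r
  = F r * w r - F l * w l - RInt (fun t => dF t * v t) l r.
Proof.
  intros Hlr Hw Hv HF HdF.
  assert (CF : forall t, l <= t <= r -> continuous F t).
  { intros t Ht; apply (ex_derive_continuous F); eexists; now apply HF. }
  assert (E1 : ex_RInt (fun t => dF t * w t) l r).
  { apply (ex_RInt_piece w w); auto. intros; eapply C1_continuous, Hw. }
  assert (E2 : ex_RInt (fun t => F t * dw t) l r).
  { apply (ex_RInt_piece dw dw); auto. intros; apply Hw. }
  assert (I : is_RInt (fun t => plus (dF t * w t) (F t * dw t)) l r
                (minus (F r * w r) (F l * w l))).
  { apply (is_RInt_derive (fun t => F t * w t)).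
    - rewrite Rmin_left, Rmax_right by assumption; intros t Ht.
      apply (is_derive_mult F w t); [now apply HF|apply Hw|intros; apply Rmult_comm].
    - rewrite Rmin_left, Rmax_right by assumption; intros t Ht.
      apply (continuous_plus (fun t => dF t * w t) (fun t => F t * dw t)).
      + apply (continuous_mult dF w); [auto|eapply C1_continuous, Hw].
      + apply (continuous_mult F dw); [auto|apply Hw]. }
  apply (is_RInt_unique (V := R_CompleteNormedModule)) in I.
  rewrite (RInt_plus (V := R_CompleteNormedModule)) in I by assumption.
  rewrite (RInt_ext (fun t => F t * Derive v t) (fun t => F t * dw t)).
  - rewrite (RInt_ext (fun t => dF t * v t) (fun t => dF t * w t)).
    + unfold minus, plus, opp in I; simpl in I. lra.
    + rewrite Rmin_left, Rmax_right by assumption; intros t Ht; now rewrite Hv.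
  - rewrite Rmin_left, Rmax_right by assumption; intros t Ht.
    now rewrite (Derive_piece v w dw l r t).
Qed.

Lemma hat_lt (v : R -> R) (l r : R) : hat_on v l r -> l < r.
Proof. intros Hv; destruct Hv as (m & ? & ? & ? & ? & ? & _); lra. Qed.

Lemma ex_RInt_hat (v G : R -> R) (l r : R) :
  hat_on v l r -> (forall t, l <= t <= r -> continuous G t) -> ex_RInt (fun t => G t * v t) l r.
Proof.
  intros Hv; destruct Hv as (m & w1 & dw1 & w2 & dw2 & Hm & C1w & C2w & E1 & E2 & _).
  intros HG; apply ex_RInt_Chasles with m.
  - apply ex_RInt_piece with w1; [lra|assumption| |intros; apply HG; lra].
    intros; eapply C1_continuous, C1w.
  - apply ex_RInt_piece with w2; [lra|assumption| |intros; apply HG; lra].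
    intros; eapply C1_continuous, C2w.
Qed.

Lemma ex_RInt_Derive_hat (v G : R -> R) (l r : R) :
  hat_on v l r -> (forall t, l <= t <= r -> continuous G t) ->
  ex_RInt (fun t => G t * Derive v t) l r.
Proof.
  intros Hv; destruct Hv as (m & w1 & dw1 & w2 & dw2 & Hm & C1w & C2w & E1 & E2 & _).
  intros HG; apply ex_RInt_Chasles with m.
  - apply ex_RInt_piece with dw1; [lra| | |intros; apply HG; lra].
    + intros; now apply (Derive_piece v w1 dw1 l m).
    + intros; apply C1w.
  - apply ex_RInt_piece with dw2; [lra| | |intros; apply HG; lra].
    + intros; now apply (Derive_piece v w2 dw2 m r).
    + intros; apply C2w.
Qed.

(** A Riemann integrable function is bounded. The bound depends on [v], hence on the degree, and is
    used only for the passage to the limit. *)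
Lemma hat_Derive_bounded (v : R -> R) (l r : R) :
  hat_on v l r ->
  exists C, 0 <= C /\ forall t, l <= t <= r -> Rabs (Derive v t) <= C.
Proof.
  intros Hv.
  destruct (ex_RInt_ub (fun t => 1 * Derive v t) l r) as [C HC].
  - apply (ex_RInt_Derive_hat v (fun _ => 1)); [assumption|].
    intros; apply continuous_const.
  - assert (H := hat_lt v l r Hv); rewrite Rmin_left, Rmax_right in HC by lra.
    assert (HC' : forall t, l <= t <= r -> Rabs (Derive v t) <= C).
    { intros t Ht; specialize (HC t Ht); rewrite Rmult_1_l in HC; exact HC. }
    exists C; split; [|exact HC'].
    apply Rle_trans with (2 := HC' l ltac:(lra)), Rabs_pos.
Qed.

Lemma RInt_by_parts_hat (v F dF : R -> R) (l r : R) :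
  hat_on v l r ->
  (forall t, l <= t <= r -> is_derive F t (dF t)) ->
  (forall t, l <= t <= r -> continuous dF t) ->
  RInt (fun t => F t * Derive v t) l r = - RInt (fun t => dF t * v t) l r.
Proof.
  intros Hv HF HdF.
  assert (X1 : ex_RInt (fun t => F t * Derive v t) l r).
  { apply ex_RInt_Derive_hat; [assumption|].
    intros t Ht; apply (ex_derive_continuous F); eexists; now apply HF. }
  assert (X2 := ex_RInt_hat v dF l r Hv HdF).
  destruct Hv as (m & w1 & dw1 & w2 & dw2 & Hm & C1w & C2w & E1 & E2 & Z1 & Zm & Z2).
  rewrite <- (RInt_Chasles (fun t => F t * Derive v t) l m r),
    <- (RInt_Chasles (fun t => dF t * v t) l m r).
  2, 4: apply ex_RInt_Chasles_1 with r; [lra|assumption].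
  2, 3: apply ex_RInt_Chasles_2 with l; [lra|assumption].
  rewrite (RInt_by_parts_piece v w1 dw1 F dF l m), (RInt_by_parts_piece v w2 dw2 F dF m r).
  all: try assumption; try lra; try (intros; apply HF; lra); try (intros; apply HdF; lra).
  (* The boundary terms at [l] and [r] vanish; those at [m] cancel because the two pieces agree
     there. *)
  unfold plus; simpl. rewrite Z1, Zm, Z2; ring.
Qed.

Lemma RInt_by_parts_hat_bound (v F dF H : R -> R) (l r I : R) :
  hat_on v l r ->
  (forall t, l <= t <= r -> is_derive F t (dF t)) ->
  (forall t, l <= t <= r -> continuous dF t) ->
  (forall t, l < t < r -> Rabs (dF t * v t) <= H t) -> is_RInt H l r I ->
  Rabs (RInt (fun t => F t * Derive v t) l r) <= I.
Proof.
  intros Hv HF HdF HH HI.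
  assert (Hlr := hat_lt v l r Hv).
  rewrite (RInt_by_parts_hat v F dF), Rabs_Ropp by assumption.
  assert (X := ex_RInt_hat v dF l r Hv HdF).
  apply Rle_trans with (1 := abs_RInt_le _ l r (Rlt_le _ _ Hlr) X).
  rewrite <- (is_RInt_unique H l r I) by assumption.
  apply RInt_le; [lra| |eexists; exact HI|assumption].
  exact (ex_RInt_norm _ l r X).
Qed.

(** * Passing to the limit in the double integral *)

Lemma RInt_uniform_limit (f : nat -> R -> R) (g : R -> R) (e I : nat -> R) (l r : R) :
  l <= r -> is_lim_seq e 0 ->
  (forall n t, l <= t <= r -> Rabs (f n t - g t) <= e n) ->
  (forall n, is_RInt (f n) l r (I n)) ->
  ex_RInt g l r /\ is_lim_seq I (RInt g l r).
Proof.
  intros Hlr He Hfg HI.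
  (* [filterlim_RInt] asks for uniform convergence on the whole line, so all functions are replaced
     by 0 outside [[l, r]]. *)
  set (cut := fun (k : R -> R) t =>
    if Rle_dec l t then if Rle_dec t r then k t else 0 else 0).
  assert (Hcut : forall k t, l < t < r -> cut k t = k t).
  { intros k t Ht; unfold cut.
    destruct (Rle_dec l t); [|lra]. destruct (Rle_dec t r); [reflexivity|lra]. }
  destruct (filterlim_RInt (V := R_CompleteNormedModule)
    (fun n => cut (f n)) l r eventually _ (cut g) I) as [J [HJ HgJ]].
  - intros n; apply is_RInt_ext with (2 := HI n).
    rewrite Rmin_left, Rmax_right by assumption; intros; now rewrite Hcut.
  - apply filterlim_locally; intros eps.
    apply is_lim_seq_spec in He; destruct (He eps) as [N HN].
    exists N; intros n Hn t.
    change (Rabs (cut (f n) t - cut g t) < eps).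
    specialize (HN n Hn); rewrite Rminus_0_r in HN.
    unfold cut; destruct (Rle_dec l t); [destruct (Rle_dec t r)|];
      try (rewrite Rminus_diag, Rabs_R0; apply eps).
    apply Rle_lt_trans with (1 := Hfg n t (conj r0 r1)).
    apply Rle_lt_trans with (2 := HN), Rle_abs.
  - assert (Hg : is_RInt g l r J).
    { apply is_RInt_ext with (2 := HgJ).
      rewrite Rmin_left, Rmax_right by assumption; intros; now rewrite Hcut. }
    split; [eexists; exact Hg|].
    rewrite (is_RInt_unique _ _ _ _ Hg); exact HJ.
Qed.

Lemma is_RInt_eq (f : R -> R) (l r I J : R) :
  is_RInt f l r I -> I = J -> is_RInt f l r J.
Proof. now intros H <-. Qed.

Lemma is_RInt_sum_below (n : nat) (f : nat -> R -> R) (l r : R) :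
  (forall k, ex_RInt (f k) l r) ->
  is_RInt (fun t => sum_below n (fun k => f k t)) l r
          (sum_below n (fun k => RInt (f k) l r)).
Proof.
  intros Hf; induction n as [|n IH].
  - unfold sum_below; simpl.
    apply (is_RInt_eq _ _ _ _ _ (is_RInt_const l r 0)), Rmult_0_r.
  - rewrite sum_below_S.
    apply is_RInt_ext with (fun t => plus (sum_below n (fun k => f k t)) (f n t)).
    + intros; now rewrite sum_below_S.
    + apply (is_RInt_plus (fun t => sum_below n (fun k => f k t)) (f n));
        [exact IH|apply (RInt_correct (f n)), Hf].
Qed.

Lemma sum_below_scal_r (n : nat) (c : R) (f : nat -> R) :
  sum_below n (fun k => f k * c) = sum_below n f * c.
Proof.
  rewrite (Rmult_comm _ c), <- sum_below_scal.
  apply sum_below_ext; intros; apply Rmult_comm.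
Qed.

Lemma continuous_gfun (s0 : R) (k : nat) (s : R) : continuous (gfun s0 k) s.
Proof.
  apply (ex_derive_continuous (gfun s0 k)); unfold gfun; auto_derive; trivial.
Qed.

Lemma continuous_kernel (alpha t s : R) :
  s < t -> continuous (fun s => Rpower (t - s) (1 - alpha)) s.
Proof.
  intros H; apply (continuous_comp (fun s => t - s) (fun y => Rpower y (1 - alpha))).
  - apply (continuous_minus (fun _ => t) (fun s => s));
      [apply continuous_const|apply continuous_id].
  - apply continuous_Rpower; lra.
Qed.

(** For fixed [t] the inner integrals differ by at most the kernel remainder times the length
    [r' - l'] and a bound on [u']; this is uniform in [t], so the outer integral converges too.
    Finite sums commute with both integrals and produce the products of moments. *)
Lemma degenerate_expansion (alpha s0 D d l r l' r' : R) (v u : R -> R) :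
  1 <= alpha <= 2 -> 0 < D -> d < 1 -> hat_on v l r -> hat_on u l' r' ->
  D <= l - s0 -> (forall s, l' <= s <= r' -> Rabs (s - s0) <= d * D) ->
  is_lim_seq
    (fun n => sum_below n (fun k =>
       RInt (fun t => hfun alpha s0 k t * Derive v t) l r
       * RInt (fun s => gfun s0 k s * Derive u s) l' r'))
    (RInt (fun t => Derive v t *
       RInt (fun s => Rpower (t - s) (1 - alpha) * Derive u s) l' r') l r).
Proof.
  intros Ha HD Hd Hv Hu Hl Hs.
  assert (Hlr := hat_lt v l r Hv); assert (Hlr' := hat_lt u l' r' Hu).
  destruct (hat_Derive_bounded v l r Hv) as [Cv [Cv0 HCv]].
  destruct (hat_Derive_bounded u l' r' Hu) as [Cu [Cu0 HCu]].
  assert (Hd0 : 0 <= d).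
  { apply Rmult_le_reg_r with D; [lra|].
    specialize (Hs l' ltac:(lra)). generalize (Rabs_pos (l' - s0)); lra. }
  set (W := fun k => RInt (fun s => gfun s0 k s * Derive u s) l' r').
  assert (XW : forall k, ex_RInt (fun s => gfun s0 k s * Derive u s) l' r').
  { intros k; apply ex_RInt_Derive_hat; [assumption|].
    intros; apply continuous_gfun. }
  assert (XQ : forall k, ex_RInt (fun t => hfun alpha s0 k t * Derive v t) l r).
  { intros k; apply ex_RInt_Derive_hat; [assumption|].
    intros; apply (ex_derive_continuous (hfun alpha s0 k)).
    eexists; apply is_derive_hfun; lra. }
  set (e := fun n => Rpower ((1 - d) * D) (1 - alpha)
     * (Rpower (1 - d) (alpha - 2) * (INR n * d ^ n) + d ^ n)).
  refine (proj2 (RInt_uniform_limit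
    (fun n t => sum_below n (fun k => hfun alpha s0 k t * Derive v t * W k)) _
    (fun n => Cv * ((r' - l') * (e n * Cu))) _ l r ltac:(lra) _ _ _)).
  - replace (Finite 0) with (Finite (Cv * ((r' - l') * (Rpower ((1 - d) * D) (1 - alpha)
      * (Rpower (1 - d) (alpha - 2) * 0 + 0) * Cu)))) by (f_equal; ring).
    apply (is_lim_seq_scal_l _ Cv (Finite _)).
    apply (is_lim_seq_scal_l _ (r' - l') (Finite _)).
    apply (is_lim_seq_scal_r _ Cu (Finite _)).
    apply (is_lim_seq_scal_l _ _ (Finite _)).
    apply is_lim_seq_plus'.
    + apply (is_lim_seq_scal_l _ _ (Finite _)), is_lim_seq_INR_pow; lra.
    + apply is_lim_seq_geom; rewrite Rabs_pos_eq; lra.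
  - intros n t Ht.
    set (S := fun s => sum_below n (fun k => hfun alpha s0 k t * gfun s0 k s)).
    (* [s - s0 <= d D < D <= t - s0], so the base of the real power is positive. *)
    assert (Hst : forall s, l' <= s <= r' -> s < t).
    { intros s Hs'. specialize (Hs s Hs'); apply Rabs_le_between in Hs. nra. }
    assert (X1 : ex_RInt (fun s => Rpower (t - s) (1 - alpha) * Derive u s) l' r').
    { apply ex_RInt_Derive_hat; [assumption|].
      intros s Hs'; apply continuous_kernel, Hst, Hs'. }
    assert (X2 : is_RInt (fun s => S s * Derive u s) l' r'
                   (sum_below n (fun k => hfun alpha s0 k t * W k))).
    { rewrite (sum_below_ext n (fun k => hfun alpha s0 k t * W k) (fun k =>
        RInt (fun s => hfun alpha s0 k t * (gfun s0 k s * Derive u s)) l' r')).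
      - apply is_RInt_ext with (fun s => sum_below n (fun k =>
          hfun alpha s0 k t * (gfun s0 k s * Derive u s))).
        + intros s _; unfold S; rewrite <- sum_below_scal_r.
          apply sum_below_ext; intros; ring.
        + apply is_RInt_sum_below; intros k.
          apply (ex_RInt_scal (fun s => gfun s0 k s * Derive u s)), XW.
      - intros k; symmetry.
        apply (RInt_scal (fun s => gfun s0 k s * Derive u s)), XW. }
    assert (X3 := is_RInt_minus _ _ _ _ _ _ X2 (RInt_correct _ _ _ X1)).
    assert (B : forall I : R, is_RInt (fun s => minus (S s * Derive u s)
                  (Rpower (t - s) (1 - alpha) * Derive u s)) l' r' I ->
                Rabs I <= (r' - l') * (e n * Cu)).
    { intros I HI; rewrite <- (is_RInt_unique _ _ _ _ HI).
      apply abs_RInt_le_const; [lra|eexists; exact HI|].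
      intros s Hs'; unfold minus, plus, opp; simpl.
      replace (S s * Derive u s + - (Rpower (t - s) (1 - alpha) * Derive u s))
        with (- (Rpower (t - s) (1 - alpha) - S s) * Derive u s) by ring.
      rewrite Rabs_mult, Rabs_Ropp.
      apply Rmult_le_compat; try apply Rabs_pos; [|now apply HCu].
      apply kernel_remainder; auto; lra. }
    specialize (B _ X3).
    rewrite (sum_below_ext n _ (fun k => Derive v t * (hfun alpha s0 k t * W k)))
      by (intros; ring).
    rewrite sum_below_scal, <- Rmult_minus_distr_l, Rabs_mult.
    apply Rmult_le_compat; try apply Rabs_pos; [now apply HCv|exact B].
  - intros n.
    rewrite (sum_below_ext n _
      (fun k => RInt (fun t => hfun alpha s0 k t * Derive v t * W k) l r)).
    + apply is_RInt_sum_below; intros k.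
      apply ex_RInt_ext with (fun t => scal (W k) (hfun alpha s0 k t * Derive v t));
        [intros; apply Rmult_comm|].
      apply (ex_RInt_scal (fun t => hfun alpha s0 k t * Derive v t)), XQ.
    + intros k; fold (W k).
      rewrite (RInt_ext (fun t => hfun alpha s0 k t * Derive v t * W k)
        (fun t => scal (W k) (hfun alpha s0 k t * Derive v t)))
        by (intros; apply Rmult_comm).
      rewrite (RInt_scal (fun t => hfun alpha s0 k t * Derive v t)) by apply XQ.
      apply Rmult_comm.
Qed.

(** * Bounds for the moments and for a single entry *)

Lemma is_RInt_abs_pow (s0 rho : R) (k : nat) :
  0 <= rho ->
  is_RInt (fun s => INR (S k) * Rabs (s - s0) ^ k) (s0 - rho) (s0 + rho)
          (2 * rho ^ S k).
Proof.
  intros Hr.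
  assert (C : forall c y, continuous (fun s => INR (S k) * (c * (s - s0)) ^ k) y).
  { intros c y; apply (ex_derive_continuous (fun s => INR (S k) * (c * (s - s0)) ^ k)).
    auto_derive; trivial. }
  apply is_RInt_eq with (plus (rho ^ S k) (rho ^ S k));
    [|unfold plus; simpl; ring].
  (* The integrand is the absolute value of the derivative of [(s - s0) ^ S k]. Splitting at [s0]
     removes the absolute value, and each half contributes [rho ^ S k]. *)
  apply (is_RInt_Chasles (fun s => INR (S k) * Rabs (s - s0) ^ k) _ s0).
  - apply is_RInt_ext with (fun s => INR (S k) * (- 1 * (s - s0)) ^ k).
    { rewrite Rmin_left, Rmax_right by lra.
      intros s Hs; rewrite <- Rabs_Ropp, Rabs_pos_eq by lra; do 2 f_equal; ring. }
    apply is_RInt_eq with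
      (minus (- (- 1 * (s0 - s0)) ^ S k) (- (- 1 * (s0 - rho - s0)) ^ S k)).
    + apply (is_RInt_derive (fun s => - (- 1 * (s - s0)) ^ S k)); intros y _; [|apply C].
      auto_derive; [trivial|]. change (Init.Nat.pred (S k)) with k.
      change (match k with 0%nat => 1 | S _ => INR k + 1 end) with (INR (S k)).
      unfold Rminus; ring.
    + unfold minus, plus, opp; simpl.
      replace (-1 * (s0 - s0)) with 0 by ring.
      replace (-1 * (s0 - rho - s0)) with rho by ring. ring.
  - apply is_RInt_ext with (fun s => INR (S k) * (1 * (s - s0)) ^ k).
    { rewrite Rmin_left, Rmax_right by lra.
      intros s Hs; rewrite Rabs_pos_eq by lra; do 2 f_equal; ring. }
    apply is_RInt_eq with
      (minus ((1 * (s0 + rho - s0)) ^ S k) ((1 * (s0 - s0)) ^ S k)).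
    + apply (is_RInt_derive (fun s => (1 * (s - s0)) ^ S k)); intros y _; [|apply C].
      auto_derive; [trivial|]. change (Init.Nat.pred (S k)) with k.
      change (match k with 0%nat => 1 | S _ => INR k + 1 end) with (INR (S k)).
      unfold Rminus; ring.
    + unfold minus, plus, opp; simpl.
      replace (1 * (s0 - s0)) with 0 by ring.
      replace (1 * (s0 + rho - s0)) with rho by ring. ring.
Qed.

(** After integration by parts, [|g_k'|] is integrated over the larger interval
    [[s0 - rho, s0 + rho]], which costs at most [2 rho ^ k]. Taking its supremum times the length
    would leave an extra factor [k] and spoil the final constant. *)
Lemma moment_bound (u : R -> R) (l r s0 rho U : R) (k : nat) :
  hat_on u l r -> s0 - rho <= l -> r <= s0 + rho ->
  (forall s, l < s < r -> Rabs (u s) <= U) ->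
  Rabs (RInt (fun s => gfun s0 k s * Derive u s) l r) <= 2 * U * rho ^ k.
Proof.
  intros Hu Hl Hr HU.
  assert (Hlr := hat_lt u l r Hu).
  assert (U0 : 0 <= U).
  { apply Rle_trans with (2 := HU ((l + r) / 2) ltac:(lra)), Rabs_pos. }
  set (H := fun s => INR k * Rabs (s - s0) ^ (k - 1)).
  assert (CH : forall y, continuous H y).
  { intros y; apply (continuous_scal_r (INR k) (fun s => Rabs (s - s0) ^ (k - 1))).
    apply (continuous_comp (fun s => Rabs (s - s0)) (fun z => z ^ (k - 1))).
    - apply (continuous_comp (fun s => s - s0) Rabs).
      + apply (continuous_minus (fun s => s) (fun _ => s0));
          [apply continuous_id|apply continuous_const].
      + apply (continuous_Rabs (y - s0)).
    - apply (ex_derive_continuous (fun z => z ^ (k - 1))); auto_derive; trivial. }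
  assert (XH : forall p q, ex_RInt H p q).
  { intros p q; apply (ex_RInt_continuous (V := R_CompleteNormedModule));
      intros; apply CH. }
  assert (PH : forall s, 0 <= H s).
  { intros s; apply Rmult_le_pos; [apply pos_INR|apply pow_le, Rabs_pos]. }
  assert (BH : RInt H l r <= 2 * rho ^ k).
  { destruct k as [|k].
    (* [g_0] is constant: the factor [INR 0] annihilates the power with truncated exponent. *)
    - rewrite (RInt_ext H (fun _ => 0)) by (intros; unfold H; simpl; ring).
      rewrite RInt_const; unfold scal; simpl; unfold mult; simpl; lra.
    - assert (T := is_RInt_unique _ _ _ _ (is_RInt_abs_pow s0 rho k ltac:(lra))).
      rewrite (RInt_ext _ H) in T.
      2:{ intros; unfold H; now replace (S k - 1)%nat with k by lia. }
      rewrite <- T.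
      rewrite <- (RInt_Chasles H (s0 - rho) l (s0 + rho)),
        <- (RInt_Chasles H l r (s0 + rho)) by apply XH.
      assert (0 <= RInt H (s0 - rho) l) by (apply RInt_ge_0; auto).
      assert (0 <= RInt H r (s0 + rho)) by (apply RInt_ge_0; auto).
      unfold plus; simpl; lra. }
  apply Rle_trans with (RInt (fun s => scal U (H s)) l r).
  - apply RInt_by_parts_hat_bound with (v := u)
      (dF := fun s => INR k * (s - s0) ^ (k - 1)) (H := fun s => scal U (H s)).
    + assumption.
    + intros s _; unfold gfun; auto_derive; [trivial|].
      rewrite <- Nat.sub_1_r; unfold Rminus; ring.
    + intros s _.
      apply (ex_derive_continuous (fun s => INR k * (s - s0) ^ (k - 1))).
      auto_derive; trivial.
    + intros s Hs; rewrite !Rabs_mult, <- RPow_abs, (Rabs_pos_eq (INR k)) by apply pos_INR.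
      rewrite Rmult_comm. apply Rmult_le_compat_r; [apply PH|now apply HU].
    + apply (RInt_correct (fun s => scal U (H s))), (ex_RInt_scal H), XH.
  - rewrite (RInt_scal H) by apply XH.
    unfold scal; simpl; unfold mult; simpl.
    rewrite (Rmult_comm 2 U), Rmult_assoc; now apply Rmult_le_compat_l.
Qed.

(** The majorant [B] is left free because its integral enters the result: the constant 2 suits modal
    functions, while a nodal function, being nonnegative, is its own majorant and contributes only
    its area. *)
Lemma hfun_moment_bound (alpha s0 D : R) (v B : R -> R) (l r V : R) (k : nat) :
  1 <= alpha <= 2 -> 0 < D -> D <= l - s0 -> hat_on v l r ->
  (forall t, l < t < r -> Rabs (v t) <= B t) -> is_RInt B l r V ->
  Rabs (RInt (fun t => hfun alpha s0 k t * Derive v t) l r)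
  <= (INR k + 1) * (Rpower D (- alpha) * (/ D) ^ k) * V.
Proof.
  intros Ha HD Hl Hv HB HV.
  apply RInt_by_parts_hat_bound with (v := v) (dF := dhfun alpha s0 k)
    (H := fun t => scal ((INR k + 1) * (Rpower D (- alpha) * (/ D) ^ k)) (B t)).
  - assumption.
  - intros t Ht; apply is_derive_hfun; lra.
  - intros t Ht; apply continuous_dhfun; lra.
  - intros t Ht; rewrite Rabs_mult.
    apply Rmult_le_compat; try apply Rabs_pos; [|now apply HB].
    apply dhfun_bound; lra.
  - apply (is_RInt_scal B), HV.
Qed.

(** The two moment bounds multiply to [2 U V D^(-alpha) (k+1) (rho/D)^k]. The resulting tail bound
    on differences of partial sums is uniform in the upper index, so it survives the limit, where
    the upper sum becomes the exact entry. *)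
Lemma entry_error (alpha s0 D rho lambda l r l' r' U V : R) (v u B : R -> R) (n : nat) :
  1 <= alpha <= 2 -> 0 < D -> 0 < lambda -> rho <= lambda / (2 + lambda) * D ->
  hat_on v l r -> hat_on u l' r' ->
  D <= l - s0 -> s0 - rho <= l' -> r' <= s0 + rho ->
  (forall t, l < t < r -> Rabs (v t) <= B t) -> is_RInt B l r V ->
  (forall s, l' < s < r' -> Rabs (u s) <= U) ->
  Rabs (RInt (fun t => Derive v t *
          RInt (fun s => Rpower (t - s) (1 - alpha) * Derive u s) l' r') l r
        - sum_below n (fun k =>
            RInt (fun t => hfun alpha s0 k t * Derive v t) l r
            * RInt (fun s => gfun s0 k s * Derive u s) l' r'))
  <= 2 * U * V * Rpower D (- alpha)
     * ((1 + lambda / 2) * (INR n + 1 + lambda / 2) * (lambda / (2 + lambda)) ^ n).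
Proof.
  intros Ha HD Hlam Hrho Hv Hu Hl Hl' Hr' HB HV HU.
  set (d := lambda / (2 + lambda)) in *.
  assert (Hd : d < 1).
  { unfold d; apply Rmult_lt_reg_r with (2 + lambda); [lra|].
    unfold Rdiv; rewrite Rmult_assoc, Rinv_l; lra. }
  assert (Hlr := hat_lt v l r Hv); assert (Hlr' := hat_lt u l' r' Hu).
  assert (U0 : 0 <= U).
  { apply Rle_trans with (2 := HU ((l' + r') / 2) ltac:(lra)), Rabs_pos. }
  assert (V0 : 0 <= V).
  { rewrite <- (is_RInt_unique _ _ _ _ HV); apply RInt_ge_0; [lra|eexists; exact HV|].
    intros t Ht; apply Rle_trans with (2 := HB t Ht), Rabs_pos. }
  assert (DE := degenerate_expansion alpha s0 D d l r l' r' v u Ha HD Hd Hv Hu Hl).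
  set (f := fun k => RInt (fun t => hfun alpha s0 k t * Derive v t) l r
            * RInt (fun s => gfun s0 k s * Derive u s) l' r') in *.
  set (E := RInt (fun t => Derive v t * _) l r) in *.
  assert (Hf : forall k, Rabs (f k)
    <= 2 * U * V * Rpower D (- alpha) * ((INR k + 1) * d ^ k)).
  { intros k; unfold f; rewrite Rabs_mult.
    assert (H1 := hfun_moment_bound alpha s0 D v B l r V k Ha HD Hl Hv HB HV).
    assert (H2 := moment_bound u l' r' s0 rho U k Hu Hl' Hr' HU).
    apply Rle_trans with (1 := Rmult_le_compat _ _ _ _
      (Rabs_pos _) (Rabs_pos _) H1 H2).
    replace ((INR k + 1) * (Rpower D (- alpha) * (/ D) ^ k) * V * (2 * U * rho ^ k))
      with (2 * U * V * Rpower D (- alpha) * ((INR k + 1) * (rho * / D) ^ k))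
      by (rewrite Rpow_mult_distr; ring).
    assert (P := Rpower_pos D (- alpha)); assert (K := pos_INR k).
    apply Rmult_le_compat_l; [repeat apply Rmult_le_pos; lra|].
    apply Rmult_le_compat_l; [lra|].
    assert (0 < / D) by now apply Rinv_0_lt_compat.
    apply pow_incr; split; [apply Rmult_le_pos; lra|].
    apply Rmult_le_reg_r with D; [lra|]. rewrite Rmult_assoc, Rinv_l; lra. }
  set (M := 2 * U * V * Rpower D (- alpha)
     * ((1 + lambda / 2) * (INR n + 1 + lambda / 2) * d ^ n)).
  assert (L : is_lim_seq (fun m => Rabs (sum_below m f - sum_below n f))
                (Rabs (E - sum_below n f))).
  { apply (is_lim_seq_abs _ (Finite _)).
    apply is_lim_seq_minus'; [|apply is_lim_seq_const].
    apply DE. intros s Hs; apply Rabs_le; lra. }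
  refine (is_lim_seq_le_loc _ (fun _ => M) _ M _ L (is_lim_seq_const M)).
  exists n; intros m Hm.
  apply arith_geom_tail; [assumption| |exact Hf|exact Hm].
  repeat apply Rmult_le_pos; try lra. left; apply Rpower_pos.
Qed.

(** * Gamma, supports and admissibility *)

(* [Gamma] is a total operator, so its sign is known only once the improper
   integral is shown to converge. *)
Lemma Gamma_nonneg (z : R) : 0 < z <= 1 -> 0 <= Gamma z.
Proof.
  intros Hz.
  set (f := fun t => Rpower t (z - 1) * exp (- t)).
  assert (Cexp : forall t, continuous (fun t => exp (- t)) t).
  { intros t; apply (ex_derive_continuous (fun t => exp (- t))); auto_derive; trivial. }
  assert (Cf : forall t, 0 < t -> continuous f t).
  { intros t Ht; apply (continuous_mult (fun t => Rpower t (z - 1)) (fun t => exp (- t)));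
      [now apply continuous_Rpower|apply Cexp]. }
  assert (Pf : forall t, 0 <= f t).
  { intros t; apply Rmult_le_pos; left; apply exp_pos. }
  assert (X : forall a b, 0 < a -> a <= b -> ex_RInt f a b).
  { intros a b Ha Hb; apply (ex_RInt_continuous (V := R_CompleteNormedModule)).
    rewrite Rmin_left, Rmax_right by assumption; intros t Ht; apply Cf; lra. }
  (* Near 0 the exponential is at most 1, and [t^(z-1)] has a bounded integral because [z > 0]. *)
  assert (I1 : forall e, 0 < e < 1 -> RInt f e 1 <= / z).
  { intros e He.
    assert (J : is_RInt (fun t => Rpower t (z - 1)) e 1
                  (minus (Rpower 1 z / z) (Rpower e z / z))).
    { apply (is_RInt_derive (fun t => Rpower t z / z));
        rewrite Rmin_left, Rmax_right by lra; intros t Ht;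
        [|apply continuous_Rpower; lra].
      apply is_derive_eq with (/ z * (z * Rpower t (z - 1))); [|field; lra].
      apply is_derive_ext with (fun t => / z * Rpower t z); [intros; apply Rmult_comm|].
      apply is_derive_scal, is_derive_Rpower; lra. }
    apply Rle_trans with (RInt (fun t => Rpower t (z - 1)) e 1).
    - apply RInt_le; [lra|apply X; lra|eexists; exact J|].
      intros t Ht; unfold f; rewrite <- (Rmult_1_r (Rpower t (z - 1))) at 2.
      apply Rmult_le_compat_l; [left; apply exp_pos|].
      rewrite <- exp_0; left; apply exp_increasing; lra.
    - rewrite (is_RInt_unique _ _ _ _ J); unfold minus, plus, opp; simpl.
      replace (Rpower 1 z) with 1 by (unfold Rpower; rewrite ln_1, Rmult_0_r, exp_0; reflexivity).
      assert (0 <= Rpower e z / z).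
      { apply Rmult_le_pos; [left; apply exp_pos|left; apply Rinv_0_lt_compat; lra]. }
      unfold Rdiv in *; lra. }
  (* Beyond 1 the power is at most 1 because [z <= 1], and the exponential dominates. *)
  assert (I2 : forall M, 1 < M -> RInt f 1 M <= 1).
  { intros M HM.
    assert (J : is_RInt (fun t => exp (- t)) 1 M (minus (- exp (- M)) (- exp (- 1)))).
    { apply (is_RInt_derive (fun t => - exp (- t))); intros t _; [|apply Cexp].
      auto_derive; [trivial|ring]. }
    apply Rle_trans with (RInt (fun t => exp (- t)) 1 M).
    - apply RInt_le; [lra|apply X; lra|eexists; exact J|].
      intros t Ht; unfold f; rewrite <- (Rmult_1_l (exp (- t))) at 2.
      apply Rmult_le_compat_r; [left; apply exp_pos|].
      apply Rle_trans with (Rpower t 0);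
        [apply Rle_Rpower; lra|rewrite Rpower_O; lra].
    - rewrite (is_RInt_unique _ _ _ _ J); unfold minus, plus, opp; simpl.
      assert (exp (- 1) < exp 0) by (apply exp_increasing; lra).
      rewrite exp_0 in *; generalize (exp_pos (- M)); lra. }
  assert (Mono : forall e M e' M', 0 < e' -> e' <= e -> e <= M -> M <= M' ->
            RInt f e M <= RInt f e' M').
  { intros e M e' M' H0 H1 H2 H3.
    rewrite <- (RInt_Chasles f e' e M'), <- (RInt_Chasles f e M M') by (apply X; lra).
    assert (0 <= RInt f e' e) by (apply RInt_ge_0; auto).
    assert (0 <= RInt f M M') by (apply RInt_ge_0; auto; apply X; lra).
    unfold plus; simpl; lra. }
  (* As [f >= 0], its integrals grow with the interval; their supremum is therefore the improper
     integral. *)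
  destruct (completeness (fun y => exists e M, 0 < e < 1 /\ 1 < M /\ y = RInt f e M))
    as [L [HL1 HL2]].
  - exists (/ z + 1); intros y (e & M & He & HM & ->).
    rewrite <- (RInt_Chasles f e 1 M) by (apply X; lra).
    unfold plus; simpl; apply Rplus_le_compat; auto.
  - exists (RInt f (1 / 2) 2), (1 / 2), 2; repeat split; lra.
  - assert (L0 : 0 <= L).
    { apply Rle_trans with (RInt f (1 / 2) 2).
      - apply RInt_ge_0; [lra|apply X; lra|auto].
      - apply HL1; exists (1 / 2), 2; repeat split; lra. }
    enough (G : is_RInt_gen f (at_right 0) (Rbar_locally p_infty) L).
    { unfold Gamma; fold f.
      rewrite (is_RInt_gen_unique (V := R_CompleteNormedModule) f L G); exact L0. }
    intros Q [eta HQ].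
    assert (N : exists e M, 0 < e < 1 /\ 1 < M /\ L - eta < RInt f e M).
    { apply Classical_Prop.NNPP; intros N.
      assert (L <= L - eta).
      { apply HL2; intros y (e & M & He & HM & ->).
        apply Rnot_lt_le; intros H; apply N; exists e, M; auto. }
      generalize (cond_pos eta); lra. }
    destruct N as (e & M & He & HM & HeM).
    apply Filter_prod with (fun y => 0 < y <= e) (fun y => M <= y).
    + exists (mkposreal e (proj1 He)); intros y Hy Hy0.
      change (Rabs (y - 0) < e) in Hy; apply Rabs_lt_between in Hy; lra.
    + exists M; intros; lra.
    + intros e' M' He' HM'; simpl.
      exists (RInt f e' M'); split; [apply (RInt_correct f), X; lra|].
      apply HQ; change (Rabs (RInt f e' M' - L) < eta).
      assert (RInt f e' M' <= L).
      { apply HL1; exists e', M'; repeat split; lra. }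
      assert (RInt f e M <= RInt f e' M') by (apply Mono; lra).
      apply Rabs_lt_between; lra.
Qed.

(** The information that fixes the bounds [Glb_Rbar] and [Lub_Rbar] in [RInt_supp]; the end points
    also place the support inside the cluster interval. *)
Definition supp_hull (f : R -> R) (l r : R) : Prop :=
  supp f l /\ supp f r /\ forall t, supp f t -> l <= t <= r.

Lemma supp_hull_intro (f : R -> R) (l r : R) :
  (forall t, f t <> 0 -> l <= t <= r) -> supp f l -> supp f r -> supp_hull f l r.
Proof.
  intros H Hl Hr; split; [|split]; try assumption.
  intros t Ht; split; apply Rnot_lt_le; intros Hlt.
  - destruct (Ht (l - t)) as [y [Hy Fy]]; [lra|].
    apply H in Fy; apply Rabs_lt_between in Hy; lra.
  - destruct (Ht (t - r)) as [y [Hy Fy]]; [lra|].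
    apply H in Fy; apply Rabs_lt_between in Hy; lra.
Qed.

Lemma RInt_supp_hull (f w : R -> R) (l r : R) :
  supp_hull f l r -> RInt_supp f w = RInt w l r.
Proof.
  intros (Hl & Hr & H); unfold RInt_supp.
  rewrite (is_glb_Rbar_unique (supp f) l), (is_lub_Rbar_unique (supp f) r).
  - reflexivity.
  - split; [intros t Ht; apply H, Ht|intros b Hb; apply Hb, Hr].
  - split; [intros t Ht; apply H, Ht|intros b Hb; apply Hb, Hl].
Qed.

Lemma diam_interval (A : R -> Prop) (l r : R) :
  is_interval A l r -> l <= r -> diam A = r - l.
Proof.
  intros H Hlr; unfold diam.
  rewrite (is_lub_Rbar_unique _ (r - l)); [reflexivity|].
  split.
  - intros t (y & z & Hy & Hz & ->); apply H in Hy; apply H in Hz.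
    apply Rabs_le; lra.
  - intros b Hb; apply Hb; exists r, l; repeat split; try (apply H; lra).
    rewrite Rabs_pos_eq; lra.
Qed.

Lemma dist_set_interval (A B : R -> Prop) (l r l' r' : R) :
  is_interval A l r -> is_interval B l' r' -> l <= r -> l' <= r' -> r' <= l ->
  dist_set A B = l - r'.
Proof.
  intros HA HB Hlr Hlr' H; unfold dist_set.
  rewrite (is_glb_Rbar_unique _ (l - r')); [reflexivity|].
  split.
  - intros t (y & z & Hy & Hz & ->); apply HA in Hy; apply HB in Hz.
    simpl; rewrite Rabs_pos_eq; lra.
  - intros b Hb; apply Hb; exists l, r'; repeat split; try (apply HA; lra);
      try (apply HB; lra). rewrite Rabs_pos_eq; lra.
Qed.

(** Common to all four kinds of entries. Hulls turn [RInt_supp] into ordinary integrals, interval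
    clusters turn [diam] and [dist_set] into differences of end points, and the absolute values in
    the constant add up to [D = a' - s0]. *)
Lemma stiffness_error (alpha lambda a' b' c' d' l r l' r' U V : R)
    (tau sigma : R -> Prop) (v u B : R -> R) (n : nat) :
  1 < alpha < 2 -> 0 < lambda -> d' < a' ->
  is_interval tau a' b' -> is_interval sigma c' d' -> admissible lambda tau sigma ->
  hat_on v l r -> hat_on u l' r' -> supp_hull v l r -> supp_hull u l' r' ->
  (forall t, supp v t -> tau t) -> (forall s, supp u s -> sigma s) ->
  (forall t, l < t < r -> Rabs (v t) <= B t) -> is_RInt B l r V ->
  (forall s, l' < s < r' -> Rabs (u s) <= U) ->
  let s0 := (c' + d') / 2 in
  Rabs (stiffness alpha v u
        - sum_below n (fun k =>
            / Gamma (2 - alpha) * RInt (fun t => hfun alpha s0 k t * Derive v t) l r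
            * RInt (fun s => gfun s0 k s * Derive u s) l' r'))
  <= 2 * U * V * (1 / Rpower (Rabs (a' - d') + Rabs (d' - s0)) alpha
        * (1 + lambda / 2) * (INR n + 1 + lambda / 2)) / Gamma (2 - alpha)
     * (lambda / (2 + lambda)) ^ n.
Proof.
  intros Ha Hlam Hda Htau Hsigma Hadm Hv Hu Sv Su Tv Tu HB HV HU s0.
  (* Nonnegativity of [Gamma] suffices, since the inverse of 0 is 0 by convention. *)
  assert (HG : 0 <= / Gamma (2 - alpha)).
  { assert (G := Gamma_nonneg (2 - alpha) ltac:(lra)).
    destruct G as [G|G]; [left; now apply Rinv_0_lt_compat|].
    rewrite <- G, Rinv_0; lra. }
  assert (Hl : a' <= l <= b') by (apply Htau, Tv, Sv).
  assert (Hl' : c' <= l' <= d') by (apply Hsigma, Tu, Su).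
  assert (Hr' : c' <= r' <= d') by (apply Hsigma, Tu, Su).
  assert (Hdiam : d' - c' <= lambda * (a' - d')).
  { unfold admissible in Hadm.
    rewrite (diam_interval sigma c' d'), (dist_set_interval tau sigma a' b' c' d')
      in Hadm by (assumption || lra).
    apply Rle_trans with (2 := Hadm), Rmax_l. }
  unfold stiffness; rewrite (RInt_supp_hull v _ l r Sv).
  rewrite (RInt_ext _ (fun t => Derive v t *
     RInt (fun s => Rpower (t - s) (1 - alpha) * Derive u s) l' r'))
    by (intros; now rewrite (RInt_supp_hull u _ l' r' Su)).
  rewrite (sum_below_ext n _ (fun k => / Gamma (2 - alpha) *
    (RInt (fun t => hfun alpha s0 k t * Derive v t) l r
     * RInt (fun s => gfun s0 k s * Derive u s) l' r'))) by (intros; ring).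
  rewrite sum_below_scal, <- Rmult_minus_distr_l, Rabs_mult.
  rewrite (Rabs_pos_eq (/ _)) by assumption.
  rewrite (Rabs_pos_eq (a' - d')), (Rabs_pos_eq (d' - s0)) by (unfold s0; lra).
  set (D := a' - d' + (d' - s0)).
  assert (EE := entry_error alpha s0 D (d' - s0) lambda l r l' r' U V v u B n).
  rewrite Rpower_Ropp in EE.
  apply Rle_trans with (/ Gamma (2 - alpha) * (2 * U * V * / Rpower D alpha *
     ((1 + lambda / 2) * (INR n + 1 + lambda / 2) * (lambda / (2 + lambda)) ^ n)));
    [|right; unfold Rdiv; ring].
  apply Rmult_le_compat_l; [assumption|].
  apply EE; try assumption; unfold D, s0; try lra.
  (* With [rho = (d' - c') / 2] and [dist = a' - d'], the claim
     [rho (2 + lambda) <= lambda (dist + rho)] reduces to [2 rho <= lambda dist]. *)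
  apply Rmult_le_reg_r with (2 + lambda); [lra|].
  field_simplify; [|lra]. nra.
Qed.

(** By the mean value theorem a second zero near [l] would give a zero of [dw] near [l], against
    continuity and [dw l <> 0]. *)
Lemma C1_zero_approx (w dw : R -> R) (l eps : R) :
  C1 w dw -> w l = 0 -> dw l <> 0 -> 0 < eps ->
  exists eta, 0 < eta <= eps /\
    forall y, Rabs (y - l) < eta -> y <> l -> w y <> 0.
Proof.
  intros Hw H0 H1 He.
  assert (C := proj2 (Hw l)).
  apply filterlim_locally with (eps := mkposreal _ (Rabs_pos_lt _ H1)) in C.
  destruct C as [eta Heta].
  exists (Rmin eta eps); split.
  { split; [apply Rmin_pos; [apply eta|assumption]|apply Rmin_r]. }
  intros y Hy Hyl Wy.
  assert (Hy' : Rabs (y - l) < eta) by (apply Rlt_le_trans with (1 := Hy), Rmin_l).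
  destruct (MVT_gen w l y dw) as [c [Hc E]].
  - intros; apply Hw.
  - intros; apply continuity_pt_filterlim; eapply C1_continuous, Hw.
  - rewrite Wy, H0, Rminus_diag in E.
    assert (Dc : dw c = 0).
    { destruct (Rmult_integral _ _ (eq_sym E)); [assumption|lra]. }
    specialize (Heta c).
    change (Rabs (c - l) < eta -> Rabs (dw c - dw l) < Rabs (dw l)) in Heta.
    rewrite Dc, Rminus_0_l, Rabs_Ropp in Heta.
    apply (Rlt_irrefl (Rabs (dw l))), Heta.
    apply Rle_lt_trans with (2 := Hy').
    revert Hc; unfold Rmin, Rmax; destruct (Rle_dec l y); intros Hc.
    + rewrite 2!Rabs_pos_eq; lra.
    + rewrite 2!Rabs_left1; lra.
Qed.

(** * Modal and nodal basis functions *)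

(** The modal function without its cut-off: a polynomial on the whole line, as the pieces in
    [hat_on] require. *)
Definition modal_shape (p : nat) (l r t : R) : R :=
  psi p ((2 * t - (l + r)) / (r - l)).

Definition dmodal_shape (p : nat) (l r t : R) : R :=
  2 / (r - l) * dpsi p ((2 * t - (l + r)) / (r - l)).

Lemma modal_inside (x : nat -> R) (i p : nat) (t : R) :
  x (i - 1)%nat <= t <= x i ->
  modal x i p t = modal_shape p (x (i - 1)%nat) (x i) t.
Proof.
  intros Ht; unfold modal.
  destruct (Rle_dec (x (i - 1)%nat) t); [|lra].
  destruct (Rle_dec t (x i)); [reflexivity|lra].
Qed.

Lemma C1_modal_shape (p : nat) (l r : R) :
  (1 <= p)%nat -> l < r -> C1 (modal_shape p l r) (dmodal_shape p l r).
Proof.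
  intros Hp Hlr t; split.
  - apply (is_derive_comp (psi p) (fun t => (2 * t - (l + r)) / (r - l))).
    + now apply is_derive_psi.
    + auto_derive; [trivial|unfold Rdiv; ring].
  - apply (continuous_scal_r (2 / (r - l))
      (fun t => dpsi p ((2 * t - (l + r)) / (r - l)))).
    apply (continuous_comp (fun t => (2 * t - (l + r)) / (r - l)) (dpsi p)).
    + apply (ex_derive_continuous (fun t => (2 * t - (l + r)) / (r - l))).
      auto_derive; trivial.
    + apply (continuous_scal_r (- (2 * INR p + 1)) (legendre p)).
      apply continuous_legendre.
Qed.

Lemma modal_shape_left (p : nat) (l r : R) :
  (1 <= p)%nat -> l < r -> modal_shape p l r l = 0 /\ dmodal_shape p l r l <> 0.
Proof.
  intros Hp Hlr; unfold modal_shape, dmodal_shape.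
  replace ((2 * l - (l + r)) / (r - l)) with (-1) by (field; lra).
  split; [now apply psi_m1|].
  apply Rmult_integral_contrapositive; split; [|apply dpsi_m1].
  apply Rgt_not_eq, Rdiv_lt_0_compat; lra.
Qed.

Lemma modal_shape_right (p : nat) (l r : R) :
  l < r -> modal_shape p l r r = 0 /\ dmodal_shape p l r r <> 0.
Proof.
  intros Hlr; unfold modal_shape, dmodal_shape.
  replace ((2 * r - (l + r)) / (r - l)) with 1 by (field; lra).
  split; [apply psi_1|].
  apply Rmult_integral_contrapositive; split; [|apply dpsi_1].
  apply Rgt_not_eq, Rdiv_lt_0_compat; lra.
Qed.

Lemma hat_on_modal (x : nat -> R) (i p : nat) :
  (1 <= p)%nat -> x (i - 1)%nat < x i ->
  hat_on (modal x i p) (x (i - 1)%nat) (x i).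
Proof.
  intros Hp Hx.
  assert (HC := C1_modal_shape p _ _ Hp Hx).
  (* A modal function has no kink inside its cell: the midpoint is an artificial node with the same
     polynomial on both sides. *)
  exists ((x (i - 1)%nat + x i) / 2); do 4 eexists.
  split; [lra|]. split; [exact HC|]. split; [exact HC|].
  repeat split; try (intros; apply modal_inside; lra).
  - now apply modal_shape_left.
  - now apply modal_shape_right.
Qed.

Lemma modal_bound (x : nat -> R) (i p : nat) (t : R) :
  x (i - 1)%nat < t < x i -> Rabs (modal x i p t) <= 2.
Proof.
  intros Ht; rewrite modal_inside by lra; apply psi_bound; split;
    apply Rmult_le_reg_r with (x i - x (i - 1)%nat); try lra;
    unfold Rdiv; rewrite Rmult_assoc, Rinv_l; lra.
Qed.

Lemma supp_hull_modal (x : nat -> R) (i p : nat) :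
  (1 <= p)%nat -> x (i - 1)%nat < x i ->
  supp_hull (modal x i p) (x (i - 1)%nat) (x i).
Proof.
  intros Hp Hx.
  assert (HC := C1_modal_shape p _ _ Hp Hx).
  destruct (modal_shape_left p _ _ Hp Hx) as [Zl Dl].
  destruct (modal_shape_right p _ _ Hx) as [Zr Dr].
  apply supp_hull_intro.
  - intros t; unfold modal.
    destruct (Rle_dec (x (i - 1)%nat) t); [|lra].
    destruct (Rle_dec t (x i)); lra.
  - intros eps Heps.
    assert (M1 := Rmin_l eps (x i - x (i - 1)%nat)).
    assert (M2 := Rmin_r eps (x i - x (i - 1)%nat)).
    (* Capping by the cell length keeps the test point inside the cell, where [modal] agrees with
       [modal_shape]. *)
    destruct (C1_zero_approx _ _ _ (Rmin eps (x i - x (i - 1)%nat)) HC Zl Dl)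
      as (eta & He & H); [apply Rmin_pos; lra|].
    exists (x (i - 1)%nat + eta / 2); split; [rewrite Rabs_pos_eq; lra|].
    rewrite modal_inside by lra; apply H; [rewrite Rabs_pos_eq|]; lra.
  - intros eps Heps.
    assert (M1 := Rmin_l eps (x i - x (i - 1)%nat)).
    assert (M2 := Rmin_r eps (x i - x (i - 1)%nat)).
    destruct (C1_zero_approx _ _ _ (Rmin eps (x i - x (i - 1)%nat)) HC Zr Dr)
      as (eta & He & H); [apply Rmin_pos; lra|].
    exists (x i - eta / 2); split; [rewrite Rabs_left1; lra|].
    rewrite modal_inside by lra; apply H; [rewrite Rabs_left1|]; lra.
Qed.

Lemma nodal_left (x : nat -> R) (j : nat) (t : R) :
  x (j - 1)%nat <= t <= x j ->
  nodal x j t = (t - x (j - 1)%nat) / (x j - x (j - 1)%nat).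
Proof.
  intros Ht; unfold nodal.
  destruct (Rle_dec (x (j - 1)%nat) t); [|lra].
  destruct (Rle_dec t (x j)); [reflexivity|lra].
Qed.

Lemma nodal_right (x : nat -> R) (j : nat) (t : R) :
  x (j - 1)%nat < x j -> x j < t <= x (j + 1)%nat ->
  nodal x j t = (x (j + 1)%nat - t) / (x (j + 1)%nat - x j).
Proof.
  intros Hx Ht; unfold nodal.
  destruct (Rle_dec (x (j - 1)%nat) t); [|lra].
  destruct (Rle_dec t (x j)); [lra|].
  destruct (Rle_dec t (x (j + 1)%nat)); [reflexivity|lra].
Qed.

Lemma hat_on_nodal (x : nat -> R) (j : nat) :
  x (j - 1)%nat < x j -> x j < x (j + 1)%nat ->
  hat_on (nodal x j) (x (j - 1)%nat) (x (j + 1)%nat).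
Proof.
  intros Hl Hr.
  exists (x j), (fun t => (t - x (j - 1)%nat) / (x j - x (j - 1)%nat)),
    (fun _ => / (x j - x (j - 1)%nat)),
    (fun t => (x (j + 1)%nat - t) / (x (j + 1)%nat - x j)),
    (fun _ => - / (x (j + 1)%nat - x j)).
  split; [lra|].
  split; [intros t; split; [|apply continuous_const]|].
  { auto_derive; [trivial|unfold Rdiv; ring]. }
  split; [intros t; split; [|apply continuous_const]|].
  { auto_derive; [trivial|unfold Rdiv; ring]. }
  repeat split.
  - intros; apply nodal_left; lra.
  - intros; apply nodal_right; lra.
  - field; lra.
  - field; lra.
  - field; lra.
Qed.

Lemma nodal_range (x : nat -> R) (j : nat) (t : R) :
  x (j - 1)%nat < x j -> x j < x (j + 1)%nat ->
  x (j - 1)%nat < t < x (j + 1)%nat -> 0 < nodal x j t <= 1.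
Proof.
  intros Hl Hr Ht; destruct (Rle_dec t (x j)) as [H|H].
  - rewrite nodal_left by lra; split.
    + apply Rdiv_lt_0_compat; lra.
    + apply Rmult_le_reg_r with (x j - x (j - 1)%nat); [lra|].
      unfold Rdiv; rewrite Rmult_assoc, Rinv_l; lra.
  - rewrite nodal_right by lra; split.
    + apply Rdiv_lt_0_compat; lra.
    + apply Rmult_le_reg_r with (x (j + 1)%nat - x j); [lra|].
      unfold Rdiv; rewrite Rmult_assoc, Rinv_l; lra.
Qed.

Lemma is_RInt_nodal (x : nat -> R) (j : nat) :
  x (j - 1)%nat < x j -> x j < x (j + 1)%nat ->
  is_RInt (nodal x j) (x (j - 1)%nat) (x (j + 1)%nat)
          ((x (j + 1)%nat - x (j - 1)%nat) / 2).
Proof.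
  intros Hl Hr.
  assert (NL := fun t => nodal_left x j t).
  assert (NR := fun t => nodal_right x j t Hl).
  revert NL NR Hl Hr.
  generalize (nodal x j) (x (j - 1)%nat) (x j) (x (j + 1)%nat).
  intros v l m r NL NR Hl Hr.
  apply is_RInt_eq with (plus ((m - l) / 2) ((r - m) / 2));
    [|unfold plus; simpl; field].
  apply (is_RInt_Chasles v _ m).
  - apply is_RInt_ext with (fun t => (t - l) / (m - l)).
    { rewrite Rmin_left, Rmax_right by lra; intros; symmetry; apply NL; lra. }
    apply is_RInt_eq with
      (minus ((m - l) ^ 2 / (2 * (m - l))) ((l - l) ^ 2 / (2 * (m - l)))).
    + apply (is_RInt_derive (fun t => (t - l) ^ 2 / (2 * (m - l)))); intros t _.
      * auto_derive; [trivial|field; lra].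
      * apply (ex_derive_continuous (fun t => (t - l) / (m - l))).
        auto_derive; trivial.
    + unfold minus, plus, opp; simpl; field; lra.
  - apply is_RInt_ext with (fun t => (r - t) / (r - m)).
    { rewrite Rmin_left, Rmax_right by lra; intros; symmetry; apply NR; lra. }
    apply is_RInt_eq with
      (minus (- (r - r) ^ 2 / (2 * (r - m))) (- (r - m) ^ 2 / (2 * (r - m)))).
    + apply (is_RInt_derive (fun t => - (r - t) ^ 2 / (2 * (r - m)))); intros t _.
      * auto_derive; [trivial|field; lra].
      * apply (ex_derive_continuous (fun t => (r - t) / (r - m))).
        auto_derive; trivial.
    + unfold minus, plus, opp; simpl; field; lra.
Qed.

Lemma supp_hull_nodal (x : nat -> R) (j : nat) :
  x (j - 1)%nat < x j -> x j < x (j + 1)%nat ->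
  supp_hull (nodal x j) (x (j - 1)%nat) (x (j + 1)%nat).
Proof.
  intros Hl Hr.
  assert (NR := fun t => nodal_range x j t Hl Hr).
  apply supp_hull_intro.
  - intros t; unfold nodal.
    destruct (Rle_dec (x (j - 1)%nat) t); [|lra].
    destruct (Rle_dec t (x j)); [lra|].
    destruct (Rle_dec t (x (j + 1)%nat)); lra.
  - intros eps Heps.
    set (e := Rmin eps (x (j + 1)%nat - x (j - 1)%nat)).
    assert (M1 : e <= eps) by apply Rmin_l.
    assert (M2 : e <= x (j + 1)%nat - x (j - 1)%nat) by apply Rmin_r.
    assert (0 < e) by (apply Rmin_pos; lra).
    exists (x (j - 1)%nat + e / 2); split; [rewrite Rabs_pos_eq; lra|].
    apply Rgt_not_eq, NR; lra.
  - intros eps Heps.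
    set (e := Rmin eps (x (j + 1)%nat - x (j - 1)%nat)).
    assert (M1 : e <= eps) by apply Rmin_l.
    assert (M2 : e <= x (j + 1)%nat - x (j - 1)%nat) by apply Rmin_r.
    assert (0 < e) by (apply Rmin_pos; lra).
    exists (x (j + 1)%nat - e / 2); split; [rewrite Rabs_left1; lra|].
    apply Rgt_not_eq, NR; lra.
Qed.

Theorem theorem3 :
  forall (alpha a b : R) (N : nat) (x : nat -> R) (P : nat -> nat)
         (lambda : R) (rk : nat) (theta1 theta2 : nat -> Prop)
         (a' b' c' d' : R),
  1 < alpha < 2 ->
  is_partition a b N x ->
  (forall i : nat, (1 <= i <= N)%nat -> (1 <= P i)%nat) ->
  0 < lambda ->
  d' < a' ->
  let s0 := (c' + d') / 2 in
  let delta := lambda / (2 + lambda) in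
  let c0 := 1 / Rpower (Rabs (a' - d') + Rabs (d' - s0)) alpha
            * (1 + lambda / 2) * (INR rk + 1 + lambda / 2) in
  let h := mesh_size x in
  ((forall i : nat, theta1 i -> (1 <= i <= N)%nat) ->
   (forall j : nat, theta2 j -> (1 <= j <= N)%nat) ->
   is_interval (tau_modal x P theta1) a' b' ->
   is_interval (tau_modal x P theta2) c' d' ->
   admissible lambda (tau_modal x P theta1) (tau_modal x P theta2) ->
   forall i j p q : nat, theta1 i -> theta2 j ->
   (1 <= p <= P i - 1)%nat -> (1 <= q <= P j - 1)%nat ->
   Rabs (entryB alpha x i j p q - approxB alpha x s0 rk i j p q)
   <= 8 * h i * c0 / Gamma (2 - alpha) * delta ^ rk)
  /\
  ((forall i : nat, theta1 i -> (1 <= i <= N - 1)%nat) ->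
   (forall j : nat, theta2 j -> (1 <= j <= N - 1)%nat) ->
   is_interval (tau_nodal x theta1) a' b' ->
   is_interval (tau_nodal x theta2) c' d' ->
   admissible lambda (tau_nodal x theta1) (tau_nodal x theta2) ->
   forall i j : nat, theta1 i -> theta2 j ->
   Rabs (entryC alpha x i j - approxC alpha x s0 rk i j)
   <= (h i + h (i + 1)%nat) * c0 / Gamma (2 - alpha) * delta ^ rk)
  /\
  ((forall i : nat, theta1 i -> (1 <= i <= N - 1)%nat) ->
   (forall j : nat, theta2 j -> (1 <= j <= N)%nat) ->
   is_interval (tau_nodal x theta1) a' b' ->
   is_interval (tau_modal x P theta2) c' d' ->
   admissible lambda (tau_nodal x theta1) (tau_modal x P theta2) ->
   forall i j q : nat, theta1 i -> theta2 j ->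
   (1 <= q <= P j - 1)%nat ->
   Rabs (entryE alpha x i j q - approxE alpha x s0 rk i j q)
   <= 2 * (h i + h (i + 1)%nat) * c0 / Gamma (2 - alpha) * delta ^ rk)
  /\
  ((forall i : nat, theta1 i -> (1 <= i <= N)%nat) ->
   (forall j : nat, theta2 j -> (1 <= j <= N - 1)%nat) ->
   is_interval (tau_modal x P theta1) a' b' ->
   is_interval (tau_nodal x theta2) c' d' ->
   admissible lambda (tau_modal x P theta1) (tau_nodal x theta2) ->
   forall i j p : nat, theta1 i -> theta2 j ->
   (1 <= p <= P i - 1)%nat ->
   Rabs (entryF alpha x i j p - approxF alpha x s0 rk i j p)
   <= 4 * h i * c0 / Gamma (2 - alpha) * delta ^ rk).
Proof.
  intros alpha a b N x P lambda rk theta1 theta2 a' b' c' d' Ha (_ & _ & _ & Hx) _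
    Hlam Hda s0 delta c0 h.
  assert (Hx' : forall i, (1 <= i <= N - 1)%nat ->
                  x (i - 1)%nat < x i /\ x i < x (i + 1)%nat).
  { intros i Hi; split; [apply Hx; lia|].
    rewrite <- (Nat.add_sub i 1) at 1; apply Hx; lia. }
  assert (Bmodal : forall i : nat,
    is_RInt (fun _ => 2) (x (i - 1)%nat) (x i) (2 * h i)).
  { intros i; apply (is_RInt_eq _ _ _ _ _ (is_RInt_const _ _ 2)).
    apply Rmult_comm. }
  (* The chain serves both roles of a nodal function: its own majorant as a row function, bound 1 as
     a column function. *)
  assert (Bnodal : forall i t, (1 <= i <= N - 1)%nat ->
    x (i - 1)%nat < t < x (i + 1)%nat -> Rabs (nodal x i t) <= nodal x i t <= 1).
  { intros i t Hi Ht.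
    assert (B := nodal_range x i t (proj1 (Hx' i Hi)) (proj2 (Hx' i Hi)) Ht).
    rewrite Rabs_pos_eq; lra. }
  assert (Hh : forall i, h i + h (i + 1)%nat = x (i + 1)%nat - x (i - 1)%nat).
  { intros i; unfold h, mesh_size; rewrite Nat.add_sub; ring. }
  split; [|split; [|split]].
  - intros T1 T2 I1 I2 Adm i j p q Hi Hj Hp Hq.
    assert (Xi := Hx i (T1 i Hi)); assert (Xj := Hx j (T2 j Hj)).
    (* The factor [2 U V] with [U = 2] and [V = 2 h_i]. *)
    replace (8 * h i * c0) with (2 * 2 * (2 * h i) * c0) by ring.
    apply (stiffness_error alpha lambda a' b' c' d' _ _ _ _ _ _ _ _
      (modal x i p) (modal x j q) (fun _ => 2) rk Ha Hlam Hda I1 I2 Adm).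
    + apply hat_on_modal; [lia|assumption].
    + apply hat_on_modal; [lia|assumption].
    + apply supp_hull_modal; [lia|assumption].
    + apply supp_hull_modal; [lia|assumption].
    + intros t Ht; now exists i, p.
    + intros t Ht; now exists j, q.
    + intros; now apply modal_bound.
    + apply Bmodal.
    + intros; now apply modal_bound.
  - intros T1 T2 I1 I2 Adm i j Hi Hj.
    destruct (Hx' i (T1 i Hi)) as [Xi Xi']; destruct (Hx' j (T2 j Hj)) as [Xj Xj'].
    (* Here [U = 1], and [V] is the area under the hat. *)
    replace ((h i + h (i + 1)%nat) * c0)
      with (2 * 1 * ((x (i + 1)%nat - x (i - 1)%nat) / 2) * c0)
      by (rewrite Hh; field).
    apply (stiffness_error alpha lambda a' b' c' d' _ _ _ _ _ _ _ _
      (nodal x i) (nodal x j) (nodal x i) rk Ha Hlam Hda I1 I2 Adm).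
    + now apply hat_on_nodal.
    + now apply hat_on_nodal.
    + now apply supp_hull_nodal.
    + now apply supp_hull_nodal.
    + intros t Ht; now exists i.
    + intros t Ht; now exists j.
    + intros; apply Bnodal; auto.
    + now apply is_RInt_nodal.
    + intros s Hs; destruct (Bnodal j s (T2 j Hj) Hs); lra.
  - intros T1 T2 I1 I2 Adm i j q Hi Hj Hq.
    destruct (Hx' i (T1 i Hi)) as [Xi Xi']; assert (Xj := Hx j (T2 j Hj)).
    replace (2 * (h i + h (i + 1)%nat) * c0)
      with (2 * 2 * ((x (i + 1)%nat - x (i - 1)%nat) / 2) * c0)
      by (rewrite Hh; field).
    apply (stiffness_error alpha lambda a' b' c' d' _ _ _ _ _ _ _ _
      (nodal x i) (modal x j q) (nodal x i) rk Ha Hlam Hda I1 I2 Adm).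
    + now apply hat_on_nodal.
    + apply hat_on_modal; [lia|assumption].
    + now apply supp_hull_nodal.
    + apply supp_hull_modal; [lia|assumption].
    + intros t Ht; now exists i.
    + intros t Ht; now exists j, q.
    + intros; apply Bnodal; auto.
    + now apply is_RInt_nodal.
    + intros; now apply modal_bound.
  - intros T1 T2 I1 I2 Adm i j p Hi Hj Hp.
    assert (Xi := Hx i (T1 i Hi)); destruct (Hx' j (T2 j Hj)) as [Xj Xj'].
    replace (4 * h i * c0) with (2 * 1 * (2 * h i) * c0) by ring.
    apply (stiffness_error alpha lambda a' b' c' d' _ _ _ _ _ _ _ _
      (modal x i p) (nodal x j) (fun _ => 2) rk Ha Hlam Hda I1 I2 Adm).
    + apply hat_on_modal; [lia|assumption].
    + now apply hat_on_nodal.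
    + apply supp_hull_modal; [lia|assumption].
    + now apply supp_hull_nodal.
    + intros t Ht; now exists i, p.
    + intros t Ht; now exists j.
    + intros; now apply modal_bound.
    + apply Bmodal.
    + intros s Hs; destruct (Bnodal j s (T2 j Hj) Hs); lra.
Qed.
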